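(* Assume that $\sum_{k=0}^\infty\|B(k)\|<\infty$, that the set $\Sigma$ associated with the equation $x(n+1)=Ax(n)+\sum_{k=0}^n B(n-k)x(k)$, $n\in\mathbb N_0$, satisfies $\Sigma\subset\{1\}$, and that the resolvent sequence $(X(n))$ of this equation is bounded. Then $$\lim_{n\to\infty}[X(n+1)-X(n)]=0\quad\text{in } L(\mathbb X).$$
   Context: $\mathbb X$ is a complex Banach space, $L(\mathbb X)$ the Banach algebra of bounded linear operators on $\mathbb X$, $\mathbb N_0=\{0,1,2,\dots\}$, $\Gamma=\{z\in\mathbb C:|z|=1\}$; $A\in L(\mathbb X)$ and $B(n)\in L(\mathbb X)$ for $n\in\mathbb N_0$. The Z-transform of $(B(n))$ is $\tilde B(z)=\sum_{j=0}^\infty B(j)z^{-j}$, $|z|>1$. A point $z_0\in\Gamma$ is called regular with respect to the equation $x(n+1)=Ax(n)+\sum_{k=0}^n B(n-k)x(k)$ if there is a neighborhood of $z_0$ in $\mathbb C$ (which may be taken to be an open disk centered at $z_0$) in which $(z-A-\tilde B(z))^{-1}$ exists as an element of $L(\mathbb X)$ for each $z$ and is holomorphic in $z$; here, at points with $|z|\le1$, $\tilde B(z)$ denotes the value of a holomorphic extension of $\tilde B$ from $\{|z|>1\}$ to that neighborhood (which is required to exist). $\Sigma$ is the set of all points of $\Gamma$ that are not regular. The resolvent sequence $(X(n))_{n\ge0}\subset L(\mathbb X)$ is the unique operator sequence with $X(0)=I$ and $X(n+1)=AX(n)+\sum_{j=0}^nB(n-j)X(j)$ for all $n\in\mathbb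 N_0$. *)

(* Defs.v *)
From Stdlib Require Import Reals Lra Lia.
From Stdlib Require Import FunctionalExtensionality PropExtensionality.
From Stdlib Require Import ProofIrrelevance ClassicalEpsilon.
From Coquelicot Require Import Coquelicot.

Open Scope R_scope.

(* Coquelicot's [is_linear] includes boundedness. *)
Record bounded_operator (X : NormedModule C_AbsRing) : Type := BoundedOperator
  { bop_fun :> X -> X;
    bop_linear : is_linear bop_fun }.

Arguments BoundedOperator {X} _ _.
Arguments bop_fun {X} _ _.
Arguments bop_linear {X} _.

Section Algebra.

Variable X : NormedModule C_AbsRing.
Local Notation L := (bounded_operator X).

Lemma bop_ext (S T : L) : (forall x, S x = T x) -> S = T.
Proof.
destruct S as [f Hf], T as [g Hg]; simpl; intros H.
assert (E : f = g) by now apply functional_extensionality.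
subst g; f_equal; apply proof_irrelevance.
Qed.

Lemma norm_scal_eq (k : C) (x : X) : norm (scal k x) = Cmod k * norm x.
Proof.
destruct (Ceq_dec k 0) as [-> | Hk].
- rewrite Cmod_0, Rmult_0_l.
  change (norm (scal (zero : C_Ring) x) = 0).
  rewrite scal_zero_l; exact (norm_zero (V := X)).
- apply Rle_antisym; [apply (norm_scal (K := C_AbsRing))|].
  assert (Hp : 0 < Cmod k) by now apply Cmod_gt_0.
  apply Rmult_le_reg_l with (/ Cmod k); [now apply Rinv_0_lt_compat|].
  rewrite <- Rmult_assoc, Rinv_l, Rmult_1_l by lra.
  rewrite <- Cmod_inv by assumption.
  replace (norm x) with (norm (scal (/ k)%C (scal k x))).
  + apply (norm_scal (K := C_AbsRing)).
  + rewrite (scal_assoc (K := C_Ring)).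
    replace (mult (/ k)%C k : C_Ring) with (one : C_Ring)
      by (symmetry; now apply Cinv_l).
    now rewrite (scal_one (K := C_Ring)).
Qed.

Lemma bop_plus_linear (S T : L) : is_linear (fun x => plus (S x) (T x)).
Proof.
apply (is_linear_comp (fun x => (S x, T x)) (fun p => plus (fst p) (snd p))).
- apply is_linear_prod; apply bop_linear.
- apply is_linear_plus.
Qed.

Lemma bop_opp_linear (T : L) : is_linear (fun x => opp (T x)).
Proof. apply (is_linear_comp T opp); [apply bop_linear | apply is_linear_opp]. Qed.

Lemma bop_scal_linear (k : C) (T : L) : is_linear (fun x => scal k (T x)).
Proof.
apply (is_linear_comp T (fun x => scal k x)); [apply bop_linear|].
apply (is_linear_scal_r (K := C_AbsRing)); apply Cmult_comm.
Qed.

Definition bop_plus (S T : L) : L := BoundedOperator _ (bop_plus_linear S T).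
Definition bop_opp (T : L) : L := BoundedOperator _ (bop_opp_linear T).
Definition bop_zero : L := BoundedOperator _ is_linear_zero.
Definition bop_scal (k : C) (T : L) : L := BoundedOperator _ (bop_scal_linear k T).
Definition bop_one : L := BoundedOperator _ is_linear_id.
Definition bop_mult (S T : L) : L :=
  BoundedOperator _ (is_linear_comp T S (bop_linear T) (bop_linear S)).

Lemma bop_plus_comm S T : bop_plus S T = bop_plus T S.
Proof. apply bop_ext; intros x; apply plus_comm. Qed.

Lemma bop_plus_assoc R S T :
  bop_plus R (bop_plus S T) = bop_plus (bop_plus R S) T.
Proof. apply bop_ext; intros x; apply plus_assoc. Qed.

Lemma bop_plus_zero_r T : bop_plus T bop_zero = T.
Proof. apply bop_ext; intros x; apply plus_zero_r. Qed.

Definition bop_AbelianMonoid_mixin :=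
  AbelianMonoid.Mixin L bop_plus bop_zero
    bop_plus_comm bop_plus_assoc bop_plus_zero_r.

Canonical bop_AbelianMonoid := AbelianMonoid.Pack L bop_AbelianMonoid_mixin L.

Lemma bop_plus_opp_r T : bop_plus T (bop_opp T) = bop_zero.
Proof. apply bop_ext; intros x; exact (plus_opp_r (T x)). Qed.

Definition bop_AbelianGroup_mixin :=
  AbelianGroup.Mixin bop_AbelianMonoid bop_opp bop_plus_opp_r.

Canonical bop_AbelianGroup :=
  AbelianGroup.Pack L (AbelianGroup.Class _ _ bop_AbelianGroup_mixin) L.

Lemma bop_mult_assoc R S T :
  bop_mult R (bop_mult S T) = bop_mult (bop_mult R S) T.
Proof. now apply bop_ext. Qed.

Lemma bop_mult_one_r T : bop_mult T bop_one = T.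
Proof. now apply bop_ext. Qed.

Lemma bop_mult_one_l T : bop_mult bop_one T = T.
Proof. now apply bop_ext. Qed.

Lemma bop_mult_plus_distr_r R S T :
  bop_mult (bop_plus R S) T = bop_plus (bop_mult R T) (bop_mult S T).
Proof. now apply bop_ext. Qed.

Lemma bop_mult_plus_distr_l R S T :
  bop_mult R (bop_plus S T) = bop_plus (bop_mult R S) (bop_mult R T).
Proof. apply bop_ext; intros x; apply (linear_plus _ (bop_linear R)). Qed.

Definition bop_Ring_mixin :=
  Ring.Mixin bop_AbelianGroup bop_mult bop_one bop_mult_assoc
    bop_mult_one_r bop_mult_one_l bop_mult_plus_distr_r bop_mult_plus_distr_l.

Canonical bop_Ring := Ring.Pack L (Ring.Class _ _ bop_Ring_mixin) L.

Lemma bop_scal_assoc (k l : C) T :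
  bop_scal k (bop_scal l T) = bop_scal (mult k l) T.
Proof. apply bop_ext; intros x; exact (scal_assoc (K := C_Ring) k l (T x)). Qed.

Lemma bop_scal_one T : bop_scal one T = T.
Proof. apply bop_ext; intros x; apply (scal_one (K := C_Ring)). Qed.

Lemma bop_scal_distr_l (k : C) S T :
  bop_scal k (bop_plus S T) = bop_plus (bop_scal k S) (bop_scal k T).
Proof. apply bop_ext; intros x; exact (scal_distr_l (K := C_Ring) k (S x) (T x)). Qed.

Lemma bop_scal_distr_r (k l : C) T :
  bop_scal (plus k l) T = bop_plus (bop_scal k T) (bop_scal l T).
Proof. apply bop_ext; intros x; exact (scal_distr_r (K := C_Ring) k l (T x)). Qed.

Definition bop_ModuleSpace_mixin :=
  ModuleSpace.Mixin C_AbsRing bop_AbelianGroup bop_scal bop_scal_assoc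
    bop_scal_one bop_scal_distr_l bop_scal_distr_r.

Canonical bop_ModuleSpace :=
  ModuleSpace.Pack C_AbsRing L (ModuleSpace.Class _ _ _ bop_ModuleSpace_mixin) L.

Definition opnorm (T : L) : R :=
  real (Lub_Rbar (fun r => exists x : X, norm x <= 1 /\ r = norm (T x))).

Lemma opnorm_lub (T : L) :
  is_lub_Rbar (fun r => exists x : X, norm x <= 1 /\ r = norm (T x)) (opnorm T).
Proof.
unfold opnorm.
set (E := fun r => exists x : X, norm x <= 1 /\ r = norm (T x)).
destruct (linear_norm _ (bop_linear T)) as [M [HM Hb]].
pose proof (Lub_Rbar_correct E) as H.
assert (Hle : Rbar_le (Lub_Rbar E) M).
{ apply H; intros r [x [Hx ->]]; simpl.
  apply Rle_trans with (1 := Hb x); nra. }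
assert (Hge : Rbar_le 0 (Lub_Rbar E)).
{ apply Rbar_le_trans with (norm (T zero)); [simpl; apply norm_ge_0|].
  apply H; exists zero; rewrite norm_zero; split; [lra | reflexivity]. }
destruct (Lub_Rbar E) as [l | |]; simpl in *; [exact H | easy | easy].
Qed.

Lemma opnorm_ge_0 T : 0 <= opnorm T.
Proof.
apply Rle_trans with (norm (T zero)); [apply norm_ge_0|].
apply (proj1 (opnorm_lub T)); exists zero; rewrite norm_zero.
split; [lra | reflexivity].
Qed.

Lemma opnorm_le (T : L) M :
  0 <= M -> (forall x, norm (T x) <= M * norm x) -> opnorm T <= M.
Proof.
intros HM H; apply (proj2 (opnorm_lub T) M).
intros r [x [Hx ->]]; simpl; apply Rle_trans with (1 := H x); nra.
Qed.

Lemma opnorm_correct (T : L) (x : X) : norm (T x) <= opnorm T * norm x.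
Proof.
destruct (Req_dec (norm x) 0) as [H0 | H0].
- rewrite H0, (norm_eq_zero _ H0), (linear_zero _ (bop_linear T)), norm_zero; lra.
- pose proof (norm_ge_0 x) as Hx.
  assert (Hp : 0 < / norm x) by (apply Rinv_0_lt_compat; lra).
  assert (Hm : Cmod (RtoC (/ norm x)) = / norm x)
    by (rewrite Cmod_R; apply Rabs_pos_eq; lra).
  assert (H : norm (T (scal (RtoC (/ norm x)) x)) <= opnorm T).
  { apply (proj1 (opnorm_lub T)); eexists; split; [|reflexivity].
    rewrite norm_scal_eq, Hm, Rinv_l; lra. }
  rewrite (linear_scal _ (bop_linear T)), norm_scal_eq, Hm in H.
  apply Rmult_le_reg_l with (/ norm x); [assumption|].
  replace (/ norm x * (opnorm T * norm x)) with (opnorm T) by (field; lra).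
  exact H.
Qed.

Lemma opnorm_triangle (S T : L) : opnorm (plus S T) <= opnorm S + opnorm T.
Proof.
pose proof (opnorm_ge_0 S); pose proof (opnorm_ge_0 T).
apply opnorm_le; [lra|]; intros x.
apply Rle_trans with (norm (S x) + norm (T x)); [apply (norm_triangle (S x))|].
rewrite Rmult_plus_distr_r; apply Rplus_le_compat; apply opnorm_correct.
Qed.

Lemma opnorm_scal (k : C) (T : L) : opnorm (scal k T) <= Cmod k * opnorm T.
Proof.
apply opnorm_le.
- apply Rmult_le_pos; [apply Cmod_ge_0 | apply opnorm_ge_0].
- intros x; change (scal k T x) with (scal k (T x)).
  rewrite norm_scal_eq, Rmult_assoc.
  apply Rmult_le_compat_l; [apply Cmod_ge_0 | apply opnorm_correct].
Qed.

Lemma opnorm_mult (S T : L) : opnorm (mult S T) <= opnorm S * opnorm T.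
Proof.
apply opnorm_le; [apply Rmult_le_pos; apply opnorm_ge_0|]; intros x.
apply Rle_trans with (opnorm S * norm (T x)); [apply (opnorm_correct S)|].
rewrite Rmult_assoc.
apply Rmult_le_compat_l; [apply opnorm_ge_0 | apply opnorm_correct].
Qed.

Lemma opnorm_eq_zero (T : L) : opnorm T = 0 -> T = zero.
Proof.
intros H; apply bop_ext; intros x; apply norm_eq_zero.
apply Rle_antisym; [|apply norm_ge_0].
apply Rle_trans with (1 := opnorm_correct T x); rewrite H; lra.
Qed.

Definition bop_ball (S : L) (e : R) (T : L) : Prop := opnorm (minus T S) < e.

Lemma bop_ball_center (T : L) (e : posreal) : bop_ball T e T.
Proof.
unfold bop_ball; rewrite minus_eq_zero.
apply Rle_lt_trans with 0; [|apply cond_pos].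
apply opnorm_le; [lra|]; intros x; simpl; rewrite norm_zero; lra.
Qed.

Lemma bop_ball_sym (S T : L) (e : R) : bop_ball S e T -> bop_ball T e S.
Proof.
unfold bop_ball; intros H; apply Rle_lt_trans with (2 := H).
apply opnorm_le; [apply opnorm_ge_0|]; intros x.
apply Rle_trans with (2 := opnorm_correct _ x).
change (norm (minus (S x) (T x)) <= norm (minus (T x) (S x))).
rewrite <- (norm_opp (minus (T x) (S x))), opp_minus; lra.
Qed.

Lemma bop_ball_triangle (Q S T : L) (e1 e2 : R) :
  bop_ball Q e1 S -> bop_ball S e2 T -> bop_ball Q (e1 + e2) T.
Proof.
unfold bop_ball; intros H1 H2.
rewrite (minus_trans S).
apply Rle_lt_trans with (1 := opnorm_triangle _ _); lra.
Qed.

Definition bop_UniformSpace_mixin :=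
  UniformSpace.Mixin L zero bop_ball
    bop_ball_center bop_ball_sym bop_ball_triangle.

Canonical bop_UniformSpace := UniformSpace.Pack L bop_UniformSpace_mixin L.

Canonical bop_NormedModuleAux :=
  NormedModuleAux.Pack C_AbsRing L
    (NormedModuleAux.Class C_AbsRing L
       (ModuleSpace.class _ bop_ModuleSpace) (UniformSpace.class bop_UniformSpace)) L.

Lemma bop_norm_compat1 (S T : L) (e : R) : opnorm (minus T S) < e -> ball S e T.
Proof. easy. Qed.

Lemma bop_norm_compat2 (S T : L) (e : posreal) :
  ball S e T -> opnorm (minus T S) < 1 * e.
Proof. now rewrite Rmult_1_l. Qed.

Definition bop_NormedModule_mixin :=
  NormedModule.Mixin C_AbsRing bop_NormedModuleAux opnorm 1
    opnorm_triangle opnorm_scal bop_norm_compat1 bop_norm_compat2 opnorm_eq_zero.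

Canonical bop_NormedModule :=
  NormedModule.Pack C_AbsRing L
    (NormedModule.Class _ _ _ bop_NormedModule_mixin) L.

End Algebra.

Arguments opnorm {X} _.

Section Complete.

Variable X : CompleteNormedModule C_AbsRing.
Local Notation L := (bounded_operator X).

Lemma bop_complete (F : (L -> Prop) -> Prop) :
  ProperFilter F -> cauchy F -> exists T : L, forall e : posreal, F (ball T e).
Proof.
intros HF HC.
set (ev (x : X) := fun S : L => S x).
assert (Hev : forall x, exists y, filterlim (ev x) F (locally y)).
{ intros x; apply (filterlim_locally_cauchy (U := X) (F := F) (ev x)); intros e.
  assert (Hd : 0 < e / 2 / (norm x + 1)).
  { pose proof (norm_ge_0 x); pose proof (cond_pos e).
    repeat apply Rdiv_lt_0_compat; lra. }
  destruct (HC (mkposreal _ Hd)) as [S0 HS].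
  exists (ball S0 (mkposreal _ Hd)); split; [exact HS|].
  intros S T H1 H2.
  apply (norm_compat1 (V := X)); unfold ev.
  assert (H : ball S (e / 2 / (norm x + 1) + e / 2 / (norm x + 1)) T)
    by (apply ball_triangle with S0; [now apply ball_sym | assumption]).
  change (opnorm (minus T S) < e / 2 / (norm x + 1) + e / 2 / (norm x + 1)) in H.
  apply Rle_lt_trans with (1 := opnorm_correct X (minus T S) x).
  pose proof (norm_ge_0 x); pose proof (opnorm_ge_0 X (minus T S)).
  apply Rle_lt_trans with (opnorm (minus T S) * (norm x + 1));
    [apply Rmult_le_compat_l; lra|].
  replace (pos e)
    with ((e / 2 / (norm x + 1) + e / 2 / (norm x + 1)) * (norm x + 1))
    by (field; lra).
  apply Rmult_lt_compat_r; lra. }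
destruct (choice (fun x y => filterlim (ev x) F (locally y)) Hev) as [f Hf].
assert (Hnorm : forall (S0 : L) d, F (ball S0 d) ->
          forall x, norm (minus (f x) (S0 x)) <= d * norm x).
{ intros S0 d HS x.
  assert (Hl : filterlim (fun S : L => norm (minus (S x) (S0 x))) F
                 (Rbar_locally (norm (minus (f x) (S0 x))))).
  { apply (filterlim_comp _ _ _ (fun S : L => minus (S x) (S0 x)) norm
             F (locally (minus (f x) (S0 x)))); [|apply filterlim_norm].
    apply (filterlim_comp_2 (G := locally (f x)) (H := locally (opp (S0 x)))
             (fun S : L => S x) (fun _ : L => opp (S0 x)) plus);
      [apply Hf | apply filterlim_const | apply (filterlim_plus (K := C_AbsRing))]. }
  apply (filterlim_le (F := F) (fun S : L => norm (minus (S x) (S0 x)))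
           (fun _ => d * norm x) (norm (minus (f x) (S0 x))) (d * norm x));
    [| exact Hl | apply filterlim_const].
  revert HS; apply filter_imp; intros S HS.
  apply Rle_trans with (1 := opnorm_correct X (minus S S0) x).
  apply Rmult_le_compat_r; [apply norm_ge_0 | now apply Rlt_le]. }
assert (Hlin : is_linear f).
{ split.
  - intros x y.
    apply (filterlim_locally_unique (F := F) (ev (plus x y))); [apply Hf|].
    apply filterlim_ext with (fun S : L => plus (S x) (S y)).
    { intros S; symmetry; apply (linear_plus _ (bop_linear S)). }
    apply (filterlim_comp_2 (G := locally (f x)) (H := locally (f y))
             (ev x) (ev y) plus);
      [apply Hf | apply Hf | apply (filterlim_plus (K := C_AbsRing))].
  - intros k x.
    apply (filterlim_locally_unique (F := F) (ev (scal k x))); [apply Hf|].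
    apply filterlim_ext with (fun S : L => scal k (S x)).
    { intros S; symmetry; apply (linear_scal _ (bop_linear S)). }
    apply (filterlim_comp _ _ _ (ev x) (scal k) F (locally (f x)));
      [apply Hf | apply (filterlim_scal_r (K := C_AbsRing))].
  - destruct (HC (mkposreal 1 Rlt_0_1)) as [S0 HS].
    exists (1 + opnorm S0); split; [pose proof (opnorm_ge_0 X S0); lra|].
    intros x.
    replace (f x) with (plus (minus (f x) (S0 x)) (S0 x))
      by (unfold minus; now rewrite <- plus_assoc, plus_opp_l, plus_zero_r).
    apply Rle_trans with (1 := norm_triangle _ _).
    rewrite Rmult_plus_distr_r.
    apply Rplus_le_compat; [exact (Hnorm _ _ HS x) | apply opnorm_correct]. }
exists (BoundedOperator f Hlin); intros e.
assert (Hd : 0 < e / 3) by (pose proof (cond_pos e); lra).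
destruct (HC (mkposreal _ Hd)) as [S0 HS].
generalize HS; apply filter_imp; intros S HS'.
apply ball_le with (2 * (e / 3) + e / 3); [lra|].
apply ball_triangle with S0; [|exact HS'].
apply ball_sym.
apply Rle_lt_trans with (e / 3); [|lra].
apply opnorm_le; [lra|]; intros x; exact (Hnorm _ _ HS x).
Qed.

Definition bop_lim (F : (L -> Prop) -> Prop) : L :=
  epsilon (inhabits (zero : L)) (fun T : L => forall e : posreal, F (ball T e)).

Lemma bop_lim_cauchy (F : (L -> Prop) -> Prop) :
  ProperFilter F -> cauchy F -> forall e : posreal, F (ball (bop_lim F) e).
Proof. intros HF HC; unfold bop_lim; apply epsilon_spec, bop_complete; assumption. Qed.

Lemma bop_lim_close (F1 F2 : (L -> Prop) -> Prop) :
  filter_le F1 F2 -> filter_le F2 F1 -> close (bop_lim F1) (bop_lim F2).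
Proof.
intros H1 H2; replace F2 with F1; [apply close_refl|].
apply functional_extensionality; intros P; apply propositional_extensionality.
split; [apply H2 | apply H1].
Qed.

Definition bop_CompleteSpace_mixin :=
  CompleteSpace.Mixin (bop_UniformSpace X) bop_lim bop_lim_cauchy bop_lim_close.

Canonical bop_CompleteSpace :=
  CompleteSpace.Pack L
    (CompleteSpace.Class L (UniformSpace.class (bop_UniformSpace X))
       bop_CompleteSpace_mixin) L.

Canonical bop_CompleteNormedModule :=
  CompleteNormedModule.Pack C_AbsRing L
    (CompleteNormedModule.Class C_AbsRing L
       (NormedModule.class C_AbsRing (bop_NormedModule X))
       bop_CompleteSpace_mixin) L.

End Complete.

Section Volterra.

Variable X : CompleteNormedModule C_AbsRing.
Local Notation L := (bounded_operator X).

Definition is_Ztransform (B : nat -> L) (z : C) (S : L) : Prop :=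
  is_series (fun j => scal (/ z ^ j)%C (B j)) S.

Definition open_disk (z0 : C) (r : R) (z : C) : Prop := Cmod (z - z0) < r.

Definition holomorphic_on (D : C -> Prop) (f : C -> L) : Prop :=
  forall z, D z -> ex_derive f z.

Definition is_inverse (S T : L) : Prop := mult S T = one /\ mult T S = one.

(* [Bt] is the extension of the Z-transform of [B] to the disk; it is unique,
   since the disk is connected and meets {|z| > 1} in a nonempty open set. *)
Definition regular_point (A : L) (B : nat -> L) (z0 : C) : Prop :=
  exists r : R, 0 < r /\
  exists Bt : C -> L,
    holomorphic_on (open_disk z0 r) Bt /\
    (forall z, open_disk z0 r z -> 1 < Cmod z -> is_Ztransform B z (Bt z)) /\
    exists Res : C -> L,
      (forall z, open_disk z0 r z ->
         is_inverse (minus (minus (scal z (one : L)) A) (Bt z)) (Res z)) /\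
      holomorphic_on (open_disk z0 r) Res.

Definition singular_set (A : L) (B : nat -> L) (z : C) : Prop :=
  Cmod z = 1 /\ ~ regular_point A B z.

(* [sum_n f n] is the sum of [f 0, ..., f n]. *)
Definition is_resolvent_sequence (A : L) (B : nat -> L) (x : nat -> L) : Prop :=
  x 0%nat = one /\
  forall n, x (S n) = plus (mult A (x n)) (sum_n (fun j => mult (B (n - j)%nat) (x j)) n).

Lemma is_resolvent_sequence_unique A B x y :
  is_resolvent_sequence A B x -> is_resolvent_sequence A B y ->
  forall n, x n = y n.
Proof.
intros [Hx0 Hx] [Hy0 Hy].
assert (H : forall n k, (k <= n)%nat -> x k = y k).
{ induction n as [|n IH]; intros k Hk.
  - replace k with 0%nat by lia; congruence.
  - destruct (Nat.eq_dec k (S n)) as [-> | Hne]; [|apply IH; lia].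
    rewrite Hx, Hy, (IH n) by lia; f_equal.
    apply sum_n_ext_loc; intros j Hj; now rewrite (IH j). }
intros n; now apply (H n).
Qed.

(* [resolvent_upto n] agrees with the resolvent sequence on [0, ..., n]. *)
Fixpoint resolvent_upto (A : L) (B : nat -> L) (n : nat) : nat -> L :=
  match n with
  | O => fun _ => one
  | S m => fun k =>
      if Nat.leb k m then resolvent_upto A B m k
      else plus (mult A (resolvent_upto A B m m))
             (sum_n (fun j => mult (B (m - j)%nat) (resolvent_upto A B m j)) m)
  end.

Definition resolvent_sequence (A : L) (B : nat -> L) (n : nat) : L :=
  resolvent_upto A B n n.

Lemma resolvent_upto_le A B n k :
  (k <= n)%nat -> resolvent_upto A B n k = resolvent_sequence A B k.
Proof.
induction n as [|n IH]; intros Hk.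
- now replace k with 0%nat by lia.
- destruct (Nat.eq_dec k (S n)) as [-> | Hne]; [reflexivity|].
  simpl; rewrite (proj2 (Nat.leb_le k n)) by lia; apply IH; lia.
Qed.

Lemma resolvent_sequence_correct A B :
  is_resolvent_sequence A B (resolvent_sequence A B).
Proof.
split; [reflexivity|]; intros n.
unfold resolvent_sequence at 1; cbn [resolvent_upto].
rewrite (proj2 (Nat.leb_gt (S n) n)) by lia.
f_equal; apply sum_n_ext_loc; intros j Hj; now rewrite resolvent_upto_le.
Qed.

End Volterra.

Arguments is_Ztransform {X}.
Arguments holomorphic_on {X}.
Arguments is_inverse {X}.
Arguments regular_point {X}.
Arguments singular_set {X}.
Arguments is_resolvent_sequence {X}.
Arguments resolvent_upto {X}.
Arguments resolvent_sequence {X}.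

(* Main.v *)
Require Import Defs.
From Stdlib Require Import Reals Lra Lia Classical ClassicalEpsilon.
From Coquelicot Require Import Coquelicot.
Open Scope R_scope.

(** The theorem is of Katznelson-Tzafriri type, and the proof is elementary: it uses
    no functional calculus and no contour integral.

    Call [y] an asymptotic solution if it is bounded and satisfies the Volterra
    equation up to an error tending to zero. These sequences form a class that is
    stable under linear combinations and under the shift, and contains the resolvent
    sequence. Sizes are measured by the seminorm [limsup |y n|], for which the shift
    is isometric.

    If the shift nearly multiplies [y] by [z], then [y j] is close to
    [z ^ - (n - j) y n] for [j] not too far from [n], so the equation says that
    [z - A - Bt z], with [Bt] the Z-transform of [B], nearly annihilates [y n];
    summability of [|B k|] controls the distant indices. Hence, where this operator
    is invertible, the shift minus [z] is bounded below on asymptotic solutions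
    ([asymptotic_solution_bounded_below]), and this holds locally uniformly near each
    regular point of the unit circle ([regular_point_bounded_below]). In other words,
    the shift has no approximate eigenvalue on the circle except possibly [1].

    It remains to see that such a shift acts as the identity modulo sequences tending
    to zero ([limsup_le_diff_zero]), a form of Gelfand's theorem on isometries whose
    spectrum is [{1}]. With [S] the shift and [m] a large integer, put
    [D_z = sum_(k < m) z ^ - k S ^ k]. Since [(S - z) D_z] telescopes to two terms,
    the lower bound gives [limsup |D_z (D_z y)| <= C] independently of [m], uniformly
    for [z] away from [1]. Fourier inversion on the [2 m]-th roots of unity, possibly
    rotated, expresses [m y (n + m - 1) - (m - 1) y (n + m)] as the average of the
    pieces [(1 - z) z ^ (m - 1) D_z (D_z y)] ([fejer_inversion]). The pieces far from
    [1] contribute [O(1)], that is, [O(1 / m)] after division by [m]. The pieces near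
    [1] cannot be estimated one by one; after averaging over small rotations their sum
    is a polynomial in the shift whose coefficients are products of two transforms, so
    that Parseval's identity bounds the sum of their absolute values
    ([sum_n_near_coeff_le]) by a multiple of the width of the near region. Letting
    first [m] tend to infinity and then that width to zero gives the claim. *)

(* Sums of complex numbers live in the canonical monoid structure of [C]; the
   ring tactic needs the carrier spelled out. *)
Ltac Ceq := match goal with |- @eq _ ?a ?b => change (@eq C a b) end.

(** * Characters of the circle *)

(** The point of the unit circle with argument [x]. *)
Definition expi (x : R) : C := (cos x, sin x).

Lemma expi_add (x y : R) : expi (x + y) = (expi x * expi y)%C.
Proof.
unfold expi, Cmult; simpl; rewrite cos_plus, sin_plus; f_equal; ring.
Qed.

Lemma expi_0 : expi 0 = RtoC 1.
Proof. unfold expi; now rewrite cos_0, sin_0. Qed.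

Lemma expi_2PI : expi (2 * PI) = RtoC 1.
Proof. unfold expi; now rewrite cos_2PI, sin_2PI. Qed.

Lemma expi_opp (x : R) : expi (- x) = Cconj (expi x).
Proof. unfold expi, Cconj; simpl; now rewrite cos_neg, sin_neg. Qed.

Lemma Cmod_expi (x : R) : Cmod (expi x) = 1.
Proof.
unfold Cmod, expi; simpl.
pose proof (sin2_cos2 x) as H; unfold Rsqr in H.
replace (cos x * (cos x * 1) + sin x * (sin x * 1)) with 1 by lra.
apply sqrt_1.
Qed.

Lemma expi_pow (x : R) (n : nat) : (expi x ^ n)%C = expi (INR n * x).
Proof.
induction n as [|n IH].
- simpl; now rewrite Rmult_0_l, expi_0.
- rewrite S_INR, Rmult_plus_distr_r, Rmult_1_l, expi_add, <- IH; simpl; ring.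
Qed.

Lemma expi_2PI_mult (n : nat) : expi (INR n * (2 * PI)) = RtoC 1.
Proof. rewrite <- expi_pow, expi_2PI, Cpow_1_l; reflexivity. Qed.

Lemma one_minus_cos (x : R) : 1 - cos x = 2 * (sin (x / 2) * sin (x / 2)).
Proof.
replace (cos x) with (cos (2 * (x / 2))) by (f_equal; lra).
rewrite cos_2a_sin; ring.
Qed.

Lemma expi_neq_1 (x : R) : 0 < x < 2 * PI -> expi x <> RtoC 1.
Proof.
intros Hx H; apply (f_equal fst) in H; unfold expi, RtoC in H; simpl in H.
pose proof (one_minus_cos x) as E.
assert (0 < sin (x / 2)) by (apply sin_gt_0; lra).
nra.
Qed.

Lemma sin_sqr_le (x : R) : sin x * sin x <= x * x.
Proof.
destruct (Rtotal_order 0 x) as [Hx | [<- | Hx]].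
- destruct (Rle_dec 1 x) as [H1 | H1].
  + pose proof (SIN_bound x); nra.
  + pose proof (sin_lt_x x Hx).
    assert (0 < sin x) by (apply sin_gt_0; pose proof PI2_1; lra); nra.
- rewrite sin_0; lra.
- destruct (Rle_dec x (-1)) as [H1 | H1].
  + pose proof (SIN_bound x); nra.
  + pose proof (sin_lt_x (- x)) as H; rewrite sin_neg in H.
    assert (0 < sin (- x)) as H' by (apply sin_gt_0; pose proof PI2_1; lra).
    rewrite sin_neg in H'; specialize (H ltac:(lra)); nra.
Qed.

Lemma Cmod_expi_minus_one (x : R) : Cmod (1 - expi x)%C <= Rabs x.
Proof.
rewrite <- (sqrt_Rsqr_abs x); unfold Cmod; apply sqrt_le_1_alt.
unfold expi, Rsqr; simpl.
pose proof (one_minus_cos x); pose proof (sin_sqr_le (x / 2)).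
pose proof (sin2_cos2 x) as H1; unfold Rsqr in H1; nra.
Qed.

Lemma Cmod_expi_minus (x y : R) : Cmod (expi x - expi y)%C <= Rabs (x - y).
Proof.
replace (expi x) with (expi y * expi (x - y))%C
  by (rewrite <- expi_add; f_equal; ring).
replace (expi y * expi (x - y) - expi y)%C with (- (expi y * (1 - expi (x - y))))%C
  by ring.
rewrite Cmod_opp, Cmod_mult, Cmod_expi, Rmult_1_l.
apply Cmod_expi_minus_one.
Qed.

(** * Finite Fourier analysis *)

Lemma sum_n_geom (q : C) (n : nat) :
  ((1 - q) * sum_n (fun i => q ^ i) n = 1 - q ^ S n)%C.
Proof.
induction n as [|n IH].
- rewrite sum_O; simpl; Ceq; ring.
- rewrite sum_Sn.
  change (plus (sum_n (fun i => q ^ i) n) (q ^ S n))%C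
    with (sum_n (fun i => q ^ i) n + q ^ S n)%C.
  rewrite Cmult_plus_distr_l, IH; simpl; Ceq; ring.
Qed.

Lemma sum_n_expi_0 (x : R) (K : nat) :
  expi x <> RtoC 1 -> expi (INR (S K) * x) = RtoC 1 ->
  sum_n (fun i => expi (INR i * x)) K = RtoC 0.
Proof.
intros H1 H2.
rewrite (sum_n_ext _ (fun i => (expi x ^ i)%C)) by (intros; now rewrite expi_pow).
pose proof (sum_n_geom (expi x) K) as H.
rewrite expi_pow, H2 in H.
assert (Hn : (1 - expi x)%C <> RtoC 0).
{ intros E; apply H1. replace (expi x) with (1 - (1 - expi x))%C by ring.
  rewrite E; ring. }
set (s := sum_n _ _) in *.
replace (s : C) with (/ (1 - expi x) * ((1 - expi x) * s))%C by (field; exact Hn).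
rewrite H; Ceq; field; exact Hn.
Qed.

(** Orthogonality of the characters of the cyclic group of order [S K]. *)
Lemma sum_n_expi_orthogonal (K a b : nat) : (a <= K)%nat -> (b <= K)%nat ->
  sum_n (fun i => expi (2 * PI / INR (S K) * INR i * (INR a - INR b))) K
  = if Nat.eqb a b then RtoC (INR (S K)) else RtoC 0.
Proof.
assert (HN : 0 < INR (S K)) by (apply lt_0_INR; lia).
pose proof PI_RGT_0 as Hpi.
assert (lt : forall a b, (b < a)%nat -> (a <= K)%nat ->
  sum_n (fun i => expi (2 * PI / INR (S K) * INR i * (INR a - INR b))) K = RtoC 0).
{ clear a b; intros a b Hab Ha.
  rewrite (sum_n_ext _ (fun i => expi (INR i * (2 * PI / INR (S K) * INR (a - b)))))
    by (intros i; f_equal; rewrite minus_INR by lia; ring).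
  apply sum_n_expi_0.
  - apply expi_neq_1.
    assert (0 < INR (a - b)) by (apply lt_0_INR; lia).
    assert (INR (a - b) < INR (S K)) by (apply lt_INR; lia).
    split.
    + apply Rmult_lt_0_compat; [apply Rdiv_lt_0_compat; lra | assumption].
    + apply Rlt_le_trans with (2 * PI / INR (S K) * INR (S K)).
      * apply Rmult_lt_compat_l; [apply Rdiv_lt_0_compat; lra | assumption].
      * right; field; lra.
  - rewrite <- (expi_2PI_mult (a - b)); f_equal; field; lra. }
intros Ha Hb.
destruct (Nat.eqb_spec a b) as [-> | Hne].
- rewrite (sum_n_ext _ (fun i => RtoC 1)).
  + clear. induction K as [|K IH].
    * rewrite sum_O; reflexivity.
    * rewrite sum_Sn, IH, (S_INR (S K)), RtoC_plus; reflexivity.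
  + intros i; rewrite Rminus_diag, Rmult_0_r; apply expi_0.
- destruct (Nat.lt_ge_cases b a) as [H | H]; [now apply lt|].
  specialize (lt b a ltac:(lia) Hb).
  assert (E : forall n, Cconj (sum_n (fun i => expi (2 * PI / INR (S K) * INR i * (INR b - INR a))) n)
     = sum_n (fun i => expi (2 * PI / INR (S K) * INR i * (INR a - INR b))) n).
  { induction n as [|n IH].
    - rewrite !sum_O, <- expi_opp; f_equal; ring.
    - rewrite !sum_Sn, <- IH.
      replace (2 * PI / INR (S K) * INR (S n) * (INR a - INR b))
        with (- (2 * PI / INR (S K) * INR (S n) * (INR b - INR a))) by ring.
      rewrite expi_opp; apply Cplus_conj. }
  rewrite <- E, lt; unfold Cconj, RtoC; simpl; now rewrite Ropp_0.
Qed.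

Lemma sum_n_eqb {G : AbelianMonoid} (f : nat -> G) (i n : nat) :
  sum_n (fun j => if Nat.eqb j i then f j else zero) n
  = if Nat.leb i n then f i else zero.
Proof.
induction n as [|n IH].
- rewrite sum_O; destruct i; reflexivity.
- rewrite sum_Sn, IH.
  destruct (Nat.eqb_spec (S n) i) as [<- | Hne].
  + rewrite Nat.leb_refl, (proj2 (Nat.leb_gt (S n) n)) by lia; apply plus_zero_l.
  + rewrite plus_zero_r.
    destruct (Nat.leb_spec i n), (Nat.leb_spec i (S n)); auto; lia.
Qed.

Lemma RtoC_sum_n (f : nat -> R) (n : nat) :
  RtoC (sum_n f n) = sum_n (fun i => RtoC (f i)) n.
Proof.
induction n as [|n IH].
- now rewrite !sum_O.
- rewrite !sum_Sn, <- IH; exact (RtoC_plus (sum_n f n) (f (S n))).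
Qed.

Lemma Cconj_sum_n (f : nat -> C) (n : nat) :
  Cconj (sum_n f n) = sum_n (fun i => Cconj (f i)) n.
Proof.
induction n as [|n IH].
- now rewrite !sum_O.
- rewrite !sum_Sn, <- IH; exact (Cplus_conj (sum_n f n) (f (S n))).
Qed.

Lemma sum_n_Cmult_l (a : C) (f : nat -> C) (n : nat) :
  sum_n (fun i => a * f i)%C n = (a * sum_n f n)%C.
Proof. exact (sum_n_mult_l (K := C_Ring) a f n). Qed.

Lemma sum_n_Cmult_r (a : C) (f : nat -> C) (n : nat) :
  sum_n (fun i => f i * a)%C n = (sum_n f n * a)%C.
Proof. exact (sum_n_mult_r (K := C_Ring) a f n). Qed.

Lemma sum_n_Cmult (f g : nat -> C) (m n : nat) :
  (sum_n f m * sum_n g n)%C = sum_n (fun i => sum_n (fun j => f i * g j)%C n) m.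
Proof.
rewrite <- sum_n_Cmult_r; apply sum_n_ext; intros i.
symmetry; apply sum_n_Cmult_l.
Qed.

(** Parseval's identity on the cyclic group of order [S K]; the group is
    parametrised by the angles [2 * PI / S K * (i - u)], [i = 0, ..., K]. *)
Lemma parseval (K : nat) (u : R) (c : nat -> C) :
  sum_n (fun t => Cmod (sum_n (fun i =>
     c i * expi (- INR t * (2 * PI / INR (S K) * (INR i - u))))%C K) ^ 2) K
  = INR (S K) * sum_n (fun i => Cmod (c i) ^ 2) K.
Proof.
apply RtoC_inj; rewrite RtoC_mult, !RtoC_sum_n.
set (h := 2 * PI / INR (S K)).
transitivity (sum_n (fun t => sum_n (fun i => sum_n (fun j =>
   (c i * Cconj (c j)) * expi (h * INR t * (INR j - INR i)))%C K) K) K).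
{ apply sum_n_ext; intros t.
  rewrite Cmod2_conj, Cconj_sum_n, sum_n_Cmult.
  apply sum_n_ext; intros i; apply sum_n_ext; intros j.
  rewrite Cmult_conj, <- expi_opp.
  replace (h * INR t * (INR j - INR i))
    with ((- INR t * (h * (INR i - u))) + - (- INR t * (h * (INR j - u)))) by ring.
  rewrite expi_add; Ceq; ring. }
rewrite sum_n_switch, <- sum_n_Cmult_l.
apply sum_n_ext_loc; intros i Hi; rewrite sum_n_switch.
transitivity (sum_n (fun j => if Nat.eqb j i
   then (INR (S K) * RtoC (Cmod (c j) ^ 2))%C else zero) K).
{ apply sum_n_ext_loc; intros j Hj.
  rewrite sum_n_Cmult_l; unfold h; rewrite sum_n_expi_orthogonal by assumption.
  destruct (Nat.eqb_spec j i) as [-> | _].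
  - rewrite Cmod2_conj; Ceq; ring.
  - Ceq; change (@zero C_AbelianMonoid) with (RtoC 0); ring. }
rewrite (sum_n_eqb (fun j => (INR (S K) * RtoC (Cmod (c j) ^ 2))%C)).
now rewrite (proj2 (Nat.leb_le i K)).
Qed.

Lemma sum_n_le (a b : nat -> R) (n : nat) :
  (forall k, (k <= n)%nat -> a k <= b k) -> sum_n a n <= sum_n b n.
Proof.
induction n as [|n IH]; intros H.
- rewrite !sum_O; auto.
- rewrite !sum_Sn; apply Rplus_le_compat; auto.
Qed.

Lemma sum_n_ge_0 (a : nat -> R) (n : nat) :
  (forall k, (k <= n)%nat -> 0 <= a k) -> 0 <= sum_n a n.
Proof.
intros H; replace 0 with (sum_n (fun _ => 0) n) by (rewrite sum_n_const; apply Rmult_0_r).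
now apply sum_n_le.
Qed.

Lemma sum_n_Rmult_l (a : R) (f : nat -> R) (n : nat) :
  sum_n (fun i => a * f i) n = a * sum_n f n.
Proof. exact (sum_n_mult_l (K := R_Ring) a f n). Qed.

Lemma norm_sum_n {V : NormedModule C_AbsRing} (f : nat -> V) (n : nat) :
  norm (sum_n f n) <= sum_n (fun i => norm (f i)) n.
Proof. apply (norm_sum_n_m f 0 n). Qed.

(** The absolute sum of a pointwise product of two transforms is controlled by the
    square sums of the transformed sequences; the parameter [d] balances the two. *)
Lemma sum_n_transform_mult_le (K : nat) (u d : R) (a b : nat -> C) : 0 < d ->
  let F c t := sum_n (fun i =>
     c i * expi (- INR t * (2 * PI / INR (S K) * (INR i - u))))%C K in
  sum_n (fun t => Cmod (F a t * F b t)%C) K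
  <= INR (S K) / 2 * (/ d * sum_n (fun i => Cmod (a i) ^ 2) K
                      + d * sum_n (fun i => Cmod (b i) ^ 2) K).
Proof.
intros Hd F.
apply Rle_trans with
  (sum_n (fun t => / 2 * (/ d * Cmod (F a t) ^ 2 + d * Cmod (F b t) ^ 2)) K).
- apply sum_n_le; intros t _; rewrite Cmod_mult.
  set (p := Cmod (F a t)); set (q := Cmod (F b t)).
  apply Rmult_le_reg_l with (2 * d); [lra|].
  replace (2 * d * (/ 2 * (/ d * p ^ 2 + d * q ^ 2))) with (p ^ 2 + (d * q) ^ 2)
    by (field; lra).
  pose proof (pow2_ge_0 (p - d * q)); nra.
- rewrite sum_n_Rmult_l.
  rewrite (sum_n_plus (G := R_AbelianMonoid) (fun t => / d * Cmod (F a t) ^ 2)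
    (fun t => d * Cmod (F b t) ^ 2)), !sum_n_Rmult_l.
  unfold F; rewrite !parseval; right; change plus with Rplus; simpl; field; lra.
Qed.

Lemma sum_n_incr (g : nat -> R) (m n : nat) : (forall t, 0 <= g t) -> (m <= n)%nat ->
  sum_n g m <= sum_n g n.
Proof.
intros Hg; induction 1 as [|n H IH]; [lra|].
rewrite sum_Sn; specialize (Hg (S n)); change (sum_n g m <= sum_n g n + g (S n)); lra.
Qed.

Lemma sum_n_shift_le (g : nat -> R) (k p K : nat) :
  (forall t, 0 <= g t) -> (k + p <= K)%nat ->
  sum_n (fun l => g (k + l)%nat) p <= sum_n g K.
Proof.
intros Hg HK; apply Rle_trans with (sum_n g (k + p)); [|now apply sum_n_incr].
clear HK; induction p as [|p IH].
- rewrite sum_O, Nat.add_0_r; destruct k as [|k].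
  + rewrite sum_O; lra.
  + rewrite sum_Sn; pose proof (sum_n_ge_0 g k (fun t _ => Hg t)) as H.
    change (g (S k) <= sum_n g k + g (S k)); lra.
- rewrite Nat.add_succ_r, !sum_Sn, Nat.add_succ_r; now apply Rplus_le_compat_r.
Qed.

(** * Windows of roots of unity near 1 *)

(** Indicator of the indices at distance at most [w] from [S p]. *)
Definition window (p w i : nat) : R :=
  if andb (Nat.leb (S p) (i + w)) (Nat.leb i (S p + w)) then 1 else 0.

Lemma window_spec p w i :
  (window p w i = 1 /\ (S p <= i + w)%nat /\ (i <= S p + w)%nat)
  \/ (window p w i = 0 /\ ((i + w < S p)%nat \/ (S p + w < i)%nat)).
Proof.
unfold window.
destruct (Nat.leb_spec (S p) (i + w)), (Nat.leb_spec i (S p + w)); simpl; auto.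
Qed.

Lemma sum_n_window p w : (w <= p)%nat ->
  sum_n (window p w) (2 * p + 1) = INR (2 * w + 1).
Proof.
intros Hw.
assert (H : forall n, sum_n (window p w) n
   = INR (Nat.min (S n) (S p + w + 1) - Nat.min (S n) (S p - w))).
{ induction n as [|n IH]; [rewrite sum_O | rewrite sum_Sn, IH].
  - destruct (window_spec p w 0) as [[-> H] | [-> H]].
    + lia.
    + change 0 with (INR 0); f_equal; lia.
  - destruct (window_spec p w (S n)) as [[-> H] | [-> H]].
    + change 1 with (INR 1).
      match goal with |- plus ?a ?b = _ => change (plus a b) with (a + b) end.
      rewrite <- plus_INR; f_equal; lia.
    + rewrite (plus_zero_r (G := R_AbelianMonoid)); f_equal; lia. }
rewrite H; f_equal; lia.
Qed.

(** The weight [(1 - z) * z ^ p] at [z = expi th]; the power of [z] makes Fourier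
    inversion select the central coefficient of the square of a geometric sum with
    [S p] terms. *)
Definition diff_weight (p : nat) (th : R) : C :=
  ((1 - expi th) * expi (INR p * th))%C.

Lemma Cmod_diff_weight p th : Cmod (diff_weight p th) <= 2.
Proof.
unfold diff_weight; rewrite Cmod_mult, Cmod_expi, Rmult_1_r.
apply Rle_trans with (1 := Cmod_triangle _ _).
rewrite Cmod_1, Cmod_opp, Cmod_expi; lra.
Qed.

(** The angles [2 * PI / (2 * S p) * (i - S p)], [i = 0, ..., 2 * p + 1], of the
    roots of unity of order [2 * S p]; the root [1] has index [i = S p]. *)
Definition root_angle (p i : nat) : R :=
  2 * PI / INR (S (2 * p + 1)) * (INR i - INR (S p)).

Lemma sum_n_root_angle p (phi : R) a t :
  (a <= 2 * p + 1)%nat -> (t <= 2 * p + 1)%nat ->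
  sum_n (fun i => expi ((INR a - INR t) * (root_angle p i + phi))) (2 * p + 1)
  = if Nat.eqb a t then RtoC (INR (S (2 * p + 1))) else RtoC 0.
Proof.
intros Ha Ht; unfold root_angle.
set (h := 2 * PI / INR (S (2 * p + 1))).
rewrite (sum_n_ext _ (fun i => (expi ((INR a - INR t) * (phi - h * INR (S p)))
  * expi (h * INR i * (INR a - INR t)))%C))
  by (intros i; rewrite <- expi_add; f_equal; ring).
rewrite sum_n_Cmult_l; unfold h; rewrite sum_n_expi_orthogonal by assumption.
destruct (Nat.eqb_spec a t) as [-> | _].
- rewrite Rminus_diag, Rmult_0_l, expi_0; Ceq; ring.
- Ceq; ring.
Qed.

Lemma sum_n_diff_weight p phi t : (t <= 2 * p + 1)%nat ->
  sum_n (fun i => diff_weight p (root_angle p i + phi)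
                  * expi (- INR t * (root_angle p i + phi)))%C (2 * p + 1)
  = ((if Nat.eqb t p then RtoC (INR (S (2 * p + 1))) else RtoC 0)
     - (if Nat.eqb t (S p) then RtoC (INR (S (2 * p + 1))) else RtoC 0))%C.
Proof.
intros Ht.
rewrite (Nat.eqb_sym t p), (Nat.eqb_sym t (S p)).
rewrite <- !(sum_n_root_angle p phi) by lia.
transitivity (sum_n (fun i =>
  plus (expi ((INR p - INR t) * (root_angle p i + phi)))
    (- (1) * expi ((INR (S p) - INR t) * (root_angle p i + phi))))%C (2 * p + 1)).
- apply sum_n_ext; intros i; unfold diff_weight.
  set (s := root_angle p i + phi).
  replace ((INR p - INR t) * s) with (INR p * s + - INR t * s) by ring.
  replace ((INR (S p) - INR t) * s) with (s + (INR p * s + - INR t * s))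
    by (rewrite S_INR; ring).
  rewrite !expi_add; Ceq; change (@plus C_AbelianMonoid) with Cplus; ring.
- rewrite (sum_n_plus (G := C_AbelianMonoid)), sum_n_Cmult_l.
  Ceq; change (@plus C_AbelianMonoid) with Cplus; ring.
Qed.

(** Up to normalisation, the coefficients of the part of the Fourier inversion
    formula over the roots of unity with index [i] at distance at most [2 * s] from
    that of [1], averaged over the rotations by the roots with index [j] at distance
    at most [s]. *)
Definition near_coeff (p s t : nat) : C :=
  sum_n (fun j => window p s j * sum_n (fun i =>
     window p (2 * s) i * diff_weight p (root_angle p i + root_angle p j)
     * expi (- INR t * (root_angle p i + root_angle p j)))%C (2 * p + 1))%C
   (2 * p + 1).

(** Averaging over rotations turns the coefficient into a combination of products of
    two transforms, because [1 - z * w = (1 - z) + z * (1 - w)]. *)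
Lemma near_coeff_factor p s t :
  let F c := sum_n (fun i => c i * expi (- INR t *
     (2 * PI / INR (S (2 * p + 1)) * (INR i - INR (S p)))))%C (2 * p + 1) in
  near_coeff p s t =
  (F (fun i => window p (2 * s) i * ((1 - expi (root_angle p i))
                                     * expi (INR p * root_angle p i)))
   * F (fun j => window p s j * expi (INR p * root_angle p j))
   + F (fun i => window p (2 * s) i * (expi (root_angle p i)
                                       * expi (INR p * root_angle p i)))
     * F (fun j => window p s j * ((1 - expi (root_angle p j))
                                   * expi (INR p * root_angle p j))))%C.
Proof.
intros F; unfold near_coeff, F; rewrite !sum_n_Cmult.
change Cplus with (@plus C_AbelianMonoid).
rewrite <- (sum_n_plus (G := C_AbelianMonoid)).
transitivity (sum_n (fun j => sum_n (fun i => window p s j * (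
     window p (2 * s) i * diff_weight p (root_angle p i + root_angle p j)
     * expi (- INR t * (root_angle p i + root_angle p j))))%C (2 * p + 1))
   (2 * p + 1)); [apply sum_n_ext; intros j; now rewrite sum_n_Cmult_l|].
rewrite sum_n_switch; apply sum_n_ext; intros i.
rewrite <- (sum_n_plus (G := C_AbelianMonoid)); apply sum_n_ext; intros j.
unfold diff_weight.
fold (root_angle p i); fold (root_angle p j).
rewrite !Rmult_plus_distr_l, !expi_add.
Ceq; change (@plus C_AbelianMonoid) with Cplus; ring.
Qed.

Lemma Cmod_window_mult p w i (c : C) r : 0 <= r ->
  (window p w i = 1 -> Cmod c <= r) -> Cmod (window p w i * c)%C ^ 2 <= r ^ 2 * window p w i.
Proof.
intros Hr H; rewrite Cmod_mult, Cmod_R.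
destruct (window_spec p w i) as [[E _] | [E _]]; rewrite E in *.
- rewrite Rabs_R1, Rmult_1_l, Rmult_1_r.
  apply pow_incr; split; [apply Cmod_ge_0 | auto].
- rewrite Rabs_R0; lra.
Qed.

(** The near coefficients are absolutely summable with a sum proportional to the
    width [d] of the near region, relative to the number [2 * s + 1] of rotations. *)
Lemma sum_n_near_coeff_le p s d : (2 * s <= p)%nat -> 0 < d ->
  (forall i, window p (2 * s) i = 1 -> Cmod (1 - expi (root_angle p i)) <= d) ->
  sum_n (fun t => Cmod (near_coeff p s t)) (2 * p + 1)
  <= INR (S (2 * p + 1)) * d * (3 * INR (2 * s + 1)).
Proof.
intros Hs Hd Hnear.
assert (Hnear' : forall j, window p s j = 1 -> Cmod (1 - expi (root_angle p j)) <= d).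
{ intros j Hj; apply Hnear.
  destruct (window_spec p s j) as [[_ H] | [H _]]; [|lra].
  destruct (window_spec p (2 * s) j) as [[H' _] | [_ H']]; [assumption | lia]. }
assert (HA : forall r (c : nat -> C) w, (w <= p)%nat -> 0 <= r ->
   (forall i, window p w i = 1 -> Cmod (c i) <= r) ->
   sum_n (fun i => Cmod (window p w i * c i)%C ^ 2) (2 * p + 1)
   <= r ^ 2 * INR (2 * w + 1)).
{ intros r c w Hw Hr H; rewrite <- (sum_n_window p) by assumption; rewrite <- sum_n_Rmult_l.
  apply sum_n_le; intros i _; now apply Cmod_window_mult; [|apply H]. }
set (u := INR (S p)).
pose proof (sum_n_transform_mult_le (2 * p + 1) u d
  (fun i => window p (2 * s) i * ((1 - expi (root_angle p i))
                                     * expi (INR p * root_angle p i)))%C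
  (fun j => window p s j * expi (INR p * root_angle p j))%C Hd) as H1.
pose proof (sum_n_transform_mult_le (2 * p + 1) u (/ d)
  (fun i => window p (2 * s) i * (expi (root_angle p i)
                                       * expi (INR p * root_angle p i)))%C
  (fun j => window p s j * ((1 - expi (root_angle p j))
                                   * expi (INR p * root_angle p j)))%C
  (Rinv_0_lt_compat _ Hd)) as H2.
cbv zeta in H1, H2.
pose proof (HA d (fun i => (1 - expi (root_angle p i))
   * expi (INR p * root_angle p i))%C (2 * s)%nat Hs ltac:(lra)) as HA1.
pose proof (HA 1 (fun i => expi (INR p * root_angle p i)) s ltac:(lia) ltac:(lra)) as HA2.
pose proof (HA 1 (fun i => expi (root_angle p i)
   * expi (INR p * root_angle p i))%C (2 * s)%nat Hs ltac:(lra)) as HA3.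
pose proof (HA d (fun i => (1 - expi (root_angle p i))
   * expi (INR p * root_angle p i))%C s ltac:(lia) ltac:(lra)) as HA4.
specialize (HA1 ltac:(intros i Hi; cbv beta; rewrite Cmod_mult, Cmod_expi, Rmult_1_r; auto)).
specialize (HA2 ltac:(intros i Hi; cbv beta; rewrite Cmod_expi; lra)).
specialize (HA3 ltac:(intros i Hi; cbv beta; rewrite Cmod_mult, !Cmod_expi; lra)).
specialize (HA4 ltac:(intros i Hi; cbv beta; rewrite Cmod_mult, Cmod_expi, Rmult_1_r; auto)).
eapply Rle_trans; [|eapply Rle_trans; [exact (Rplus_le_compat _ _ _ _ H1 H2)|]].
- rewrite <- (sum_n_plus (G := R_AbelianMonoid)).
  apply sum_n_le; intros t _; rewrite near_coeff_factor; apply Cmod_triangle.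
- clear H1 H2.
  set (N := INR (S (2 * p + 1))).
  assert (HN : 0 <= N) by apply pos_INR.
  assert (Ha : INR (2 * (2 * s) + 1) <= 2 * INR (2 * s + 1)).
  { change 2 with (INR 2); rewrite <- mult_INR; apply le_INR; lia. }
  set (a := INR (2 * (2 * s) + 1)) in *; set (b := INR (2 * s + 1)) in *.
  apply Rle_trans with (N / 2 * (/ d * (d ^ 2 * a) + d * (1 ^ 2 * b))
     + N / 2 * (/ / d * (1 ^ 2 * a) + / d * (d ^ 2 * b))).
  + assert (Hd' : 0 <= / d) by (apply Rlt_le, Rinv_0_lt_compat, Hd).
    assert (Hd'' : 0 <= / / d) by (rewrite Rinv_inv; lra).
    apply Rplus_le_compat; apply Rmult_le_compat_l; try lra;
      apply Rplus_le_compat; apply Rmult_le_compat_l; assumption || lra.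
  + rewrite Rinv_inv.
    replace (N / 2 * (/ d * (d ^ 2 * a) + d * (1 ^ 2 * b))
      + N / 2 * (d * (1 ^ 2 * a) + / d * (d ^ 2 * b))) with (N * d * (a + b))
      by (field; lra).
    apply Rmult_le_compat_l; [apply Rmult_le_pos; lra | lra].
Qed.

(** * Identities in abelian groups *)

Lemma minus_plus_telescope {G : AbelianGroup} (u w a b c : G) :
  minus u w = minus a c -> minus (plus u b) (plus w a) = minus b c.
Proof.
intros H; transitivity (plus b (plus (minus u w) (opp a))).
- unfold minus; rewrite opp_plus, (plus_comm u b), !plus_assoc; reflexivity.
- rewrite H; unfold minus.
  rewrite (plus_comm a), <- plus_assoc; f_equal.
  transitivity (plus (opp c) zero); [f_equal; apply plus_opp_r | apply plus_zero_r].
Qed.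

Lemma minus_minus_plus {G : AbelianGroup} (a b c : G) :
  minus (minus a b) c = minus a (plus b c).
Proof. unfold minus; rewrite opp_plus, plus_assoc; reflexivity. Qed.

Lemma plus_plus_interchange {G : AbelianMonoid} (a b c d : G) :
  plus (plus a b) (plus c d) = plus (plus a c) (plus b d).
Proof.
rewrite <- !plus_assoc; f_equal; rewrite !plus_assoc; f_equal; apply plus_comm.
Qed.

Lemma minus_plus_plus {G : AbelianGroup} (a b c d : G) :
  plus (minus a b) (minus c d) = minus (plus a c) (plus b d).
Proof. unfold minus; rewrite opp_plus; apply plus_plus_interchange. Qed.

Lemma sum_n_minus {G : AbelianGroup} (f g : nat -> G) n :
  sum_n (fun j => minus (f j) (g j)) n = minus (sum_n f n) (sum_n g n).
Proof.
induction n as [|n IH]; [now rewrite !sum_O|].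
rewrite !sum_Sn, IH; apply minus_plus_plus.
Qed.

Lemma minus_split {G : AbelianGroup} (p q a c s t : G) :
  minus (minus q a) s
  = plus (opp (minus p q)) (plus (minus p (plus a c)) (plus (minus c t) (minus t s))).
Proof.
rewrite <- (minus_trans t), <- minus_minus_plus, <- (minus_trans c), opp_minus.
rewrite !minus_minus_plus; apply minus_trans.
Qed.

(** * Asymptotic bounds of sequences *)

Section Sequences.

Variable V : NormedModule C_AbsRing.
Implicit Types (x y z : nat -> V).

(** [limsup_le y r] says that [limsup |y n| <= r]. *)
Definition limsup_le (y : nat -> V) (r : R) : Prop :=
  forall e, 0 < e -> eventually (fun n => norm (y n) <= r + e).

Lemma limsup_le_ext y z r :
  (forall n, y n = z n) -> limsup_le y r -> limsup_le z r.
Proof.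
intros E H e He; generalize (H e He); apply filter_imp.
intros n; now rewrite E.
Qed.

Lemma limsup_le_bounded y r : (forall n, norm (y n) <= r) -> limsup_le y r.
Proof.
intros H e He; exists 0%nat; intros n _; specialize (H n); lra.
Qed.

Lemma limsup_le_weaken y r s : r <= s -> limsup_le y r -> limsup_le y s.
Proof.
intros Hrs H e He; generalize (H e He); apply filter_imp; intros n; lra.
Qed.

Lemma limsup_le_closed y r :
  (forall e, 0 < e -> limsup_le y (r + e)) -> limsup_le y r.
Proof.
intros H e He; generalize (H (e / 2) ltac:(lra) (e / 2) ltac:(lra)).
apply filter_imp; intros n; lra.
Qed.

Lemma limsup_le_plus y z r s : limsup_le y r -> limsup_le z s ->
  limsup_le (fun n => plus (y n) (z n)) (r + s).
Proof.
intros Hy Hz e He.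
generalize (filter_and (F := eventually) _ _ (Hy (e / 2) ltac:(lra)) (Hz (e / 2) ltac:(lra))).
apply filter_imp; intros n [H1 H2].
pose proof (norm_triangle (y n) (z n)); lra.
Qed.

Lemma norm_scal_le (c : C) (v : V) : norm (scal c v) <= Cmod c * norm v.
Proof. apply (norm_scal (K := C_AbsRing)). Qed.

Lemma limsup_le_scal (c : C) y r :
  limsup_le y r -> limsup_le (fun n => scal c (y n)) (Cmod c * r).
Proof.
intros Hy e He; pose proof (Cmod_ge_0 c) as Hc.
assert (He' : 0 < e / (Cmod c + 1)) by (apply Rdiv_lt_0_compat; lra).
generalize (Hy _ He'); apply filter_imp; intros n H.
apply Rle_trans with (1 := norm_scal_le c (y n)).
apply Rle_trans with (Cmod c * (r + e / (Cmod c + 1)));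
  [now apply Rmult_le_compat_l|].
assert (Cmod c * (e / (Cmod c + 1)) <= e); [|lra].
apply Rle_trans with ((Cmod c + 1) * (e / (Cmod c + 1)));
  [apply Rmult_le_compat_r; lra | right; field; lra].
Qed.

Lemma limsup_le_minus y z r s : limsup_le y r -> limsup_le z s ->
  limsup_le (fun n => minus (y n) (z n)) (r + s).
Proof.
intros Hy Hz; apply limsup_le_plus; [assumption|].
intros e He; generalize (Hz e He); apply filter_imp; intros n H.
now rewrite norm_opp.
Qed.

Lemma limsup_le_sum_n (f : nat -> nat -> V) (r : nat -> R) (K : nat) :
  (forall k, (k <= K)%nat -> limsup_le (f k) (r k)) ->
  limsup_le (fun n => sum_n (fun k => f k n) K) (sum_n r K).
Proof.
induction K as [|K IH]; intros H.
- rewrite sum_O; apply limsup_le_ext with (f 0%nat); [|auto].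
  intros n; now rewrite sum_O.
- rewrite sum_Sn.
  apply limsup_le_ext with (fun n => plus (sum_n (fun k => f k n) K) (f (S K) n)).
  + intros n; now rewrite sum_Sn.
  + apply limsup_le_plus; auto.
Qed.

Lemma limsup_le_shift y r k : limsup_le y r -> limsup_le (fun n => y (n + k)%nat) r.
Proof.
intros H e He; destruct (H e He) as [N HN].
exists N; intros n Hn; apply HN; lia.
Qed.

Lemma limsup_le_unshift y r k : limsup_le (fun n => y (n + k)%nat) r -> limsup_le y r.
Proof.
intros H e He; destruct (H e He) as [N HN].
exists (N + k)%nat; intros n Hn.
replace n with ((n - k) + k)%nat by lia; apply HN; lia.
Qed.

(** If the limsup of a bounded sequence is at most [c] plus half of itself, it is at
    most [2 * c]. *)
Lemma limsup_le_absorb y M c : (forall n, norm (y n) <= M) ->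
  (forall r, limsup_le y r -> limsup_le y (c + r / 2)) -> limsup_le y (2 * c).
Proof.
intros HM H.
assert (Hk : forall k, limsup_le y (2 * c + Rabs (M - 2 * c) * (/ 2) ^ k)).
{ induction k as [|k IH].
  - apply limsup_le_bounded; intros n; apply Rle_trans with (1 := HM n).
    pose proof (Rle_abs (M - 2 * c)); simpl; lra.
  - apply limsup_le_weaken with (2 := H _ IH); simpl; lra. }
apply limsup_le_closed; intros e He.
pose proof (Rabs_pos (M - 2 * c)) as Ha.
destruct (pow_lt_1_zero (/ 2)) with (y := e / (Rabs (M - 2 * c) + 1)) as [N HN].
- rewrite Rabs_pos_eq; lra.
- apply Rdiv_lt_0_compat; lra.
- specialize (HN N (Nat.le_refl N)).
  rewrite Rabs_pos_eq in HN by (apply pow_le; lra).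
  apply limsup_le_weaken with (2 := Hk N); apply Rplus_le_compat_l.
  apply Rle_trans with ((Rabs (M - 2 * c) + 1) * (/ 2) ^ N).
  + apply Rmult_le_compat_r; [apply pow_le|]; lra.
  + apply Rle_trans with ((Rabs (M - 2 * c) + 1) * (e / (Rabs (M - 2 * c) + 1)));
      [apply Rmult_le_compat_l; lra | right; field; lra].
Qed.

(** * Fejer sums *)

(** The geometric sum with [S p] terms in the shift divided by [expi th], applied to
    [y]. The shift multiplies the result by [expi th] up to an error that does not
    grow with [p], see [geom_shift_telescope]. *)
Definition geom_shift (th : R) (p : nat) (y : nat -> V) (n : nat) : V :=
  sum_n (fun k => scal (expi (- INR k * th)) (y (n + k)%nat)) p.

Lemma geom_shift_telescope th p y n :
  minus (geom_shift th p y (S n)) (scal (expi th) (geom_shift th p y n))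
  = minus (scal (expi (- INR p * th)) (y (n + S p)%nat)) (scal (expi th) (y n)).
Proof.
unfold geom_shift; induction p as [|p IH].
- rewrite !sum_O; simpl INR.
  replace (- 0 * th) with 0 by ring; rewrite expi_0.
  change (RtoC 1) with (one : C_Ring).
  rewrite !(scal_one (K := C_Ring)), !Nat.add_0_r, Nat.add_1_r; reflexivity.
- rewrite !sum_Sn, (scal_distr_l (K := C_Ring)).
  replace (S n + S p)%nat with (n + S (S p))%nat by lia.
  rewrite (scal_assoc (K := C_Ring)).
  replace (mult (expi th : C_Ring) (expi (- INR (S p) * th))) with (expi (- INR p * th)).
  2: { change (expi (- INR p * th) = expi th * expi (- INR (S p) * th))%C.
       rewrite <- expi_add; f_equal; rewrite S_INR; ring. }
  exact (minus_plus_telescope _ _ _ _ _ IH).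
Qed.

Lemma limsup_le_geom_shift_telescope th p y r : limsup_le y r ->
  limsup_le (fun n => minus (geom_shift th p y (S n))
                            (scal (expi th) (geom_shift th p y n))) (2 * r).
Proof.
intros H.
eapply limsup_le_ext; [intros n; symmetry; apply geom_shift_telescope|].
replace (2 * r) with (Cmod (expi (- INR p * th)) * r + Cmod (expi th) * r)
  by (rewrite !Cmod_expi; ring).
apply limsup_le_minus; apply limsup_le_scal; [|assumption].
now apply limsup_le_shift.
Qed.

Lemma geom_shift_twice th p y n :
  geom_shift th p (geom_shift th p y) n
  = sum_n (fun k => sum_n (fun l =>
      scal (expi (- INR (k + l) * th)) (y (n + (k + l))%nat)) p) p.
Proof.
unfold geom_shift at 1; apply sum_n_ext; intros k.
unfold geom_shift; rewrite <- (sum_n_scal_l (K := C_Ring)).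
apply sum_n_ext; intros l.
rewrite (scal_assoc (K := C_Ring)), Nat.add_assoc; f_equal.
change (expi (- INR k * th) * expi (- INR l * th) = expi (- INR (k + l) * th))%C.
rewrite <- expi_add, plus_INR; f_equal; ring.
Qed.

Lemma sum_n_scal_r (f : nat -> C) (v : V) (n : nat) :
  sum_n (fun i => scal (f i) v) n = scal (sum_n f n : C) v.
Proof.
induction n as [|n IH].
- now rewrite !sum_O.
- rewrite !sum_Sn, IH; symmetry; exact (scal_distr_r (K := C_Ring) _ _ v).
Qed.

Lemma sum_n_geom_shift_twice (w : nat -> C) (th : nat -> R) K p y n :
  sum_n (fun i => scal (w i) (geom_shift (th i) p (geom_shift (th i) p y) n)) K
  = sum_n (fun k => sum_n (fun l =>
      scal (sum_n (fun i => w i * expi (- INR (k + l) * th i))%C K : C)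
        (y (n + (k + l))%nat)) p) p.
Proof.
transitivity (sum_n (fun i => sum_n (fun k => sum_n (fun l =>
  scal (w i * expi (- INR (k + l) * th i))%C (y (n + (k + l))%nat)) p) p) K).
- apply sum_n_ext; intros i; rewrite geom_shift_twice, <- (sum_n_scal_l (K := C_Ring)).
  apply sum_n_ext; intros k; rewrite <- (sum_n_scal_l (K := C_Ring)).
  apply sum_n_ext; intros l; exact (scal_assoc (K := C_Ring) _ _ _).
- rewrite sum_n_switch; apply sum_n_ext; intros k.
  rewrite sum_n_switch; apply sum_n_ext; intros l.
  apply sum_n_scal_r.
Qed.

Lemma scal_scal_comm (a b : C) (v : V) : scal a (scal b v) = scal b (scal a v).
Proof.
rewrite !(scal_assoc (K := C_Ring)); f_equal; apply Cmult_comm.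
Qed.

Lemma sum_n_vconst (v : V) n : sum_n (fun _ => v) n = scal (RtoC (INR (S n))) v.
Proof.
induction n as [|n IH].
- rewrite sum_O; symmetry; apply (scal_one (K := C_Ring)).
- rewrite sum_Sn, IH, (S_INR (S n)), RtoC_plus.
  rewrite <- (scal_one (K := C_Ring) v) at 2.
  symmetry; exact (scal_distr_r (K := C_Ring) _ _ v).
Qed.

Lemma sum_n_vconst_tail (v : V) n :
  sum_n (fun k => if Nat.leb 1 k then v else zero) n = scal (RtoC (INR n)) v.
Proof.
induction n as [|n IH].
- rewrite sum_O; symmetry; exact (scal_zero_l (K := C_Ring) v).
- rewrite sum_Sn, IH, (S_INR n), RtoC_plus.
  etransitivity; [|symmetry; exact (scal_distr_r (K := C_Ring) _ _ v)].
  f_equal; symmetry; exact (scal_one (K := C_Ring) v).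
Qed.

Lemma sum_n_antidiagonal p a v : (p <= a)%nat ->
  sum_n (fun k => sum_n (fun l => if Nat.eqb (k + l) a then v else zero) p) p
  = sum_n (fun k => if Nat.leb a (k + p) then v else zero : V) p.
Proof.
intros Ha; apply sum_n_ext_loc; intros k Hk.
rewrite (sum_n_ext _ (fun l => if Nat.eqb l (a - k) then v else zero)).
- rewrite (sum_n_eqb (fun _ => v)).
  destruct (Nat.leb_spec (a - k) p), (Nat.leb_spec a (k + p)); auto; lia.
- intros l; destruct (Nat.eqb_spec (k + l) a), (Nat.eqb_spec l (a - k)); auto; lia.
Qed.

(** Fourier inversion: summing the weighted double geometric sums over the roots of
    unity of order [2 * S p], rotated by [phi], leaves two terms of [y], which up to a
    relative error [1 / S p] form a difference of consecutive terms. *)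
Lemma fejer_inversion p phi y n :
  sum_n (fun i => scal (diff_weight p (root_angle p i + phi))
    (geom_shift (root_angle p i + phi) p
       (geom_shift (root_angle p i + phi) p y) n)) (2 * p + 1)
  = scal (RtoC (INR (S (2 * p + 1))))
      (minus (scal (RtoC (INR (S p))) (y (n + p)%nat))
             (scal (RtoC (INR p)) (y (n + S p)%nat))).
Proof.
rewrite sum_n_geom_shift_twice.
set (N := RtoC (INR (S (2 * p + 1)))).
transitivity (sum_n (fun k => sum_n (fun l =>
  plus (if Nat.eqb (k + l) p then scal N (y (n + p)%nat) else zero)
       (if Nat.eqb (k + l) (S p) then opp (scal N (y (n + S p)%nat)) else zero)) p) p).
{ apply sum_n_ext_loc; intros k Hk; apply sum_n_ext_loc; intros l Hl.
  rewrite sum_n_diff_weight by lia; fold N.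
  destruct (Nat.eqb_spec (k + l) p) as [E | _];
    [|destruct (Nat.eqb_spec (k + l) (S p)) as [E | _]].
  - rewrite (proj2 (Nat.eqb_neq (k + l) (S p))) by lia.
    rewrite plus_zero_r, E; f_equal; ring.
  - rewrite plus_zero_l, E, <- (scal_opp_l (K := C_Ring)); f_equal.
    change (0 - N = - N)%C; ring.
  - rewrite plus_zero_l.
    replace (0 - 0)%C with (zero : C_Ring) by (change (RtoC 0 = 0 - 0)%C; ring).
    apply (scal_zero_l (K := C_Ring)). }
rewrite (sum_n_ext _ _ _ (fun k => sum_n_plus _ _ p)), sum_n_plus.
rewrite !sum_n_antidiagonal by lia.
rewrite (sum_n_ext (fun k => if Nat.leb p (k + p) then _ else _)
  (fun _ => scal N (y (n + p)%nat)))
  by (intros k; now rewrite (proj2 (Nat.leb_le p (k + p))) by lia).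
rewrite sum_n_vconst.
unfold minus; etransitivity; [|symmetry; exact (scal_distr_l (K := C_Ring) _ _ _)].
f_equal; [apply scal_scal_comm|].
rewrite (sum_n_ext _ (fun k => if Nat.leb 1 k
  then opp (scal N (y (n + S p)%nat)) else zero)).
- rewrite sum_n_vconst_tail, !(scal_opp_r (K := C_Ring)); f_equal.
  apply scal_scal_comm.
- intros k; destruct (Nat.leb_spec (S p) (k + p)), (Nat.leb_spec 1 k); auto; lia.
Qed.


(** The contribution of the angle [th] to the Fourier inversion formula. *)
Definition fejer_piece (p : nat) (y : nat -> V) (th : R) (n : nat) : V :=
  scal (diff_weight p th) (geom_shift th p (geom_shift th p y) n).

Lemma limsup_le_fejer_piece p y th D : 0 <= D ->
  limsup_le (geom_shift th p (geom_shift th p y)) D ->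
  limsup_le (fejer_piece p y th) (2 * D).
Proof.
intros HD H; apply limsup_le_weaken with (Cmod (diff_weight p th) * D).
- apply Rmult_le_compat_r; [assumption | apply Cmod_diff_weight].
- now apply limsup_le_scal.
Qed.

Lemma near_part_expand p s y n :
  sum_n (fun j => scal (RtoC (window p s j)) (sum_n (fun i =>
     scal (RtoC (window p (2 * s) i))
       (fejer_piece p y (root_angle p i + root_angle p j) n)) (2 * p + 1))) (2 * p + 1)
  = sum_n (fun k => sum_n (fun l =>
      scal (near_coeff p s (k + l)) (y (n + (k + l))%nat)) p) p.
Proof.
transitivity (sum_n (fun j => sum_n (fun k => sum_n (fun l =>
  scal (window p s j * sum_n (fun i =>
     window p (2 * s) i * diff_weight p (root_angle p i + root_angle p j)
     * expi (- INR (k + l) * (root_angle p i + root_angle p j)))%C (2 * p + 1))%C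
   (y (n + (k + l))%nat)) p) p) (2 * p + 1)).
- apply sum_n_ext; intros j.
  rewrite (sum_n_ext _ (fun i =>
    scal (window p (2 * s) i * diff_weight p (root_angle p i + root_angle p j))%C
      (geom_shift (root_angle p i + root_angle p j) p
         (geom_shift (root_angle p i + root_angle p j) p y) n)))
    by (intros i; exact (scal_assoc (K := C_Ring) _ _ _)).
  rewrite sum_n_geom_shift_twice, <- (sum_n_scal_l (K := C_Ring)).
  apply sum_n_ext; intros k; rewrite <- (sum_n_scal_l (K := C_Ring)).
  apply sum_n_ext; intros l; exact (scal_assoc (K := C_Ring) _ _ _).
- rewrite sum_n_switch; apply sum_n_ext; intros k.
  rewrite sum_n_switch; apply sum_n_ext; intros l.
  apply sum_n_scal_r.
Qed.

Lemma limsup_le_near_part p s d P y : (2 * s <= p)%nat -> 0 < d -> 0 <= P ->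
  (forall i, window p (2 * s) i = 1 -> Cmod (1 - expi (root_angle p i)) <= d) ->
  limsup_le y P ->
  limsup_le (fun n => sum_n (fun j => scal (RtoC (window p s j)) (sum_n (fun i =>
     scal (RtoC (window p (2 * s) i))
       (fejer_piece p y (root_angle p i + root_angle p j) n)) (2 * p + 1))) (2 * p + 1))
    (INR (S p) * (INR (S (2 * p + 1)) * d * (3 * INR (2 * s + 1))) * P).
Proof.
intros Hs Hd HP Hnear Hy.
eapply limsup_le_ext; [intros n; symmetry; apply near_part_expand|].
apply limsup_le_weaken with
  (sum_n (fun k => sum_n (fun l => Cmod (near_coeff p s (k + l)) * P) p) p).
- rewrite Rmult_assoc, <- (sum_n_const p).
  apply sum_n_le; intros k Hk.
  rewrite (sum_n_mult_r (K := R_Ring) P).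
  apply Rmult_le_compat_r; [assumption|].
  apply Rle_trans with (2 := sum_n_near_coeff_le p s d Hs Hd Hnear).
  apply (sum_n_shift_le (fun t => Cmod (near_coeff p s t)));
    [intros; apply Cmod_ge_0 | lia].
- apply (limsup_le_sum_n (fun k n => sum_n (fun l =>
    scal (near_coeff p s (k + l)) (y (n + (k + l))%nat)) p)); intros k _.
  apply (limsup_le_sum_n (fun l n =>
    scal (near_coeff p s (k + l)) (y (n + (k + l))%nat))); intros l _.
  now apply limsup_le_scal, limsup_le_shift.
Qed.

Lemma limsup_le_far_part p s D y : (s <= p)%nat -> 0 <= D ->
  (forall i j, (i <= 2 * p + 1)%nat -> window p (2 * s) i = 0 -> window p s j = 1 ->
     limsup_le (geom_shift (root_angle p i + root_angle p j) p
        (geom_shift (root_angle p i + root_angle p j) p y)) D) ->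
  limsup_le (fun n => sum_n (fun j => scal (RtoC (window p s j)) (sum_n (fun i =>
     scal (1 - RtoC (window p (2 * s) i))%C
       (fejer_piece p y (root_angle p i + root_angle p j) n)) (2 * p + 1))) (2 * p + 1))
    (INR (2 * s + 1) * (INR (S (2 * p + 1)) * (2 * D))).
Proof.
intros Hs HD Hfar.
rewrite <- (sum_n_window p) by assumption.
rewrite <- (sum_n_mult_r (K := R_Ring)
  (INR (S (2 * p + 1)) * (2 * D)) (window p s)).
apply (limsup_le_sum_n (fun j n => scal (RtoC (window p s j)) (sum_n (fun i =>
     scal (1 - RtoC (window p (2 * s) i))%C
       (fejer_piece p y (root_angle p i + root_angle p j) n)) (2 * p + 1)))).
intros j _.
assert (H0 : forall z : nat -> V, limsup_le (fun n => scal (RtoC 0) (z n)) 0).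
{ intros z; apply limsup_le_bounded; intros n.
  apply Rle_trans with (1 := norm_scal_le _ _); rewrite Cmod_0; lra. }
destruct (window_spec p s j) as [[Ej _] | [Ej _]]; rewrite Ej.
2: { change (mult (K := R_Ring) 0 ?x) with (0 * x); rewrite Rmult_0_l; apply H0. }
match goal with |- limsup_le (fun n => scal _ (@?z n)) ?r =>
  replace r with (Cmod (RtoC 1) * (INR (S (2 * p + 1)) * (2 * D)))
    by (rewrite Cmod_1; reflexivity);
  apply (limsup_le_scal (RtoC 1) z)
end.
rewrite <- sum_n_const.
apply (limsup_le_sum_n (fun i n => scal (1 - RtoC (window p (2 * s) i))%C
       (fejer_piece p y (root_angle p i + root_angle p j) n))).
intros i Hi.
destruct (window_spec p (2 * s) i) as [[Ei _] | [Ei _]]; rewrite Ei.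
- replace (1 - 1)%C with (RtoC 0) by ring.
  apply limsup_le_weaken with 0; [lra | apply H0].
- replace (1 - 0)%C with (RtoC 1) by ring.
  replace (2 * D) with (Cmod (RtoC 1) * (2 * D)) by (rewrite Cmod_1; ring).
  now apply limsup_le_scal, limsup_le_fejer_piece, Hfar.
Qed.

Lemma limsup_le_scal_inv (c : C) y r : c <> RtoC 0 ->
  limsup_le (fun n => scal c (y n)) r -> limsup_le y (/ Cmod c * r).
Proof.
intros Hc H; rewrite <- Cmod_inv by assumption.
apply limsup_le_ext with (fun n => scal (/ c)%C (scal c (y n)));
  [|now apply limsup_le_scal].
intros n; rewrite (scal_assoc (K := C_Ring)).
replace (mult (/ c)%C c : C_Ring) with (one : C_Ring)
  by (symmetry; now apply Cinv_l).
now rewrite (scal_one (K := C_Ring)).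
Qed.

(** If the double geometric sums of [y] are bounded by [D] away from [1], the
    differences of consecutive terms of [y] are bounded in terms of the width [d] of
    the excluded neighbourhood of [1], up to an error of order [1 / S p]. *)
Theorem limsup_le_diff p s d D P y : (2 * s <= p)%nat -> 0 < d -> 0 <= D -> 0 <= P ->
  limsup_le y P ->
  (forall i, window p (2 * s) i = 1 -> Cmod (1 - expi (root_angle p i)) <= d) ->
  (forall i j, (i <= 2 * p + 1)%nat -> window p (2 * s) i = 0 -> window p s j = 1 ->
     limsup_le (geom_shift (root_angle p i + root_angle p j) p
        (geom_shift (root_angle p i + root_angle p j) p y)) D) ->
  limsup_le (fun n => minus (y n) (y (S n))) (3 * d * P + (2 * D + P) / INR (S p)).
Proof.
intros Hs Hd HD HP Hy Hnear Hfar.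
set (N := INR (S (2 * p + 1))); set (b := INR (2 * s + 1)); set (m := INR (S p)).
assert (HN : 0 < N) by (apply lt_0_INR; lia).
assert (Hb : 0 < b) by (apply lt_0_INR; lia).
assert (Hm : 0 < m) by (apply lt_0_INR; lia).
set (Z n := minus (scal (RtoC (INR (S p))) (y (n + p)%nat))
                  (scal (RtoC (INR p)) (y (n + S p)%nat))).
assert (HZ : limsup_le Z (3 * m * d * P + 2 * D)).
{ replace (3 * m * d * P + 2 * D) with
    (/ Cmod (b * N)%C * (m * (N * d * (3 * b)) * P + b * (N * (2 * D)))).
  2: { rewrite Cmod_mult, !Cmod_R, !Rabs_pos_eq by lra; field; lra. }
  apply limsup_le_scal_inv.
  { rewrite <- RtoC_mult; intros E; apply RtoC_inj in E.
    pose proof (Rmult_lt_0_compat _ _ Hb HN); lra. }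
  eapply limsup_le_ext; [|apply limsup_le_plus;
    [apply (limsup_le_near_part p s d P y) | apply (limsup_le_far_part p s D y)];
    assumption || lia].
  intros n; cbv beta; rewrite <- sum_n_plus.
  transitivity (sum_n (fun j => scal (RtoC (window p s j)) (scal (RtoC N) (Z n)))
                  (2 * p + 1)).
  - apply sum_n_ext; intros j; unfold Z, N.
    rewrite <- (fejer_inversion p (root_angle p j) y n).
    etransitivity; [symmetry; exact (scal_distr_l (K := C_Ring) _ _ _)|]; f_equal.
    etransitivity; [symmetry; exact (sum_n_plus _ _ _)|].
    apply sum_n_ext; intros i.
    etransitivity; [symmetry; exact (scal_distr_r (K := C_Ring) _ _ _)|].
    etransitivity; [|exact (scal_one (K := C_Ring) _)]; f_equal.
    change (RtoC (window p (2 * s) i) + (1 - RtoC (window p (2 * s) i)) = 1)%C; ring.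
  - rewrite sum_n_scal_r, <- RtoC_sum_n, sum_n_window by lia.
    exact (scal_assoc (K := C_Ring) _ _ _). }
apply limsup_le_unshift with p.
replace (3 * d * P + (2 * D + P) / m)
  with (/ Cmod (RtoC m) * ((3 * m * d * P + 2 * D) + P)).
2: { rewrite Cmod_R, Rabs_pos_eq by lra; field; lra. }
apply limsup_le_scal_inv; [intros E; apply RtoC_inj in E; lra|].
apply limsup_le_ext with (fun n => minus (Z n) (y (n + S p)%nat)).
- intros n; unfold Z, m.
  set (u := y (n + p)%nat); set (v := y (n + S p)%nat).
  replace (y (S (n + p))) with v by (unfold v; f_equal; lia).
  transitivity (minus (scal (RtoC (INR (S p))) u) (plus (scal (RtoC (INR p)) v) v)).
  + exact (minus_minus_plus _ _ _).
  + etransitivity; [|symmetry; exact (scal_minus_distr_l (K := C_Ring) _ _ _)]; f_equal.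
    rewrite S_INR, RtoC_plus.
    etransitivity; [|symmetry; exact (scal_distr_r (K := C_Ring) _ _ _)]; f_equal.
    symmetry; exact (scal_one (K := C_Ring) v).
- apply limsup_le_minus; [exact HZ | now apply limsup_le_shift].
Qed.

(** * Bounded sequences without approximate eigenvalues away from 1 *)

(** A class of sequences stable under linear combinations and the shift. *)
Record shift_invariant (M : (nat -> V) -> Prop) : Prop := ShiftInvariant
  { inv_ext : forall y z, (forall n, y n = z n) -> M y -> M z;
    inv_shift : forall y, M y -> M (fun n => y (S n));
    inv_plus : forall y z, M y -> M z -> M (fun n => plus (y n) (z n));
    inv_scal : forall (c : C) y, M y -> M (fun n => scal c (y n)) }.

(** On [M], in the seminorm [limsup |y n|], the shift minus [expi th] is bounded below
    by [1 / c]. *)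
Definition shift_bounded_below (M : (nat -> V) -> Prop) (th c : R) : Prop :=
  forall y r, M y -> 0 <= r ->
    limsup_le (fun n => minus (y (S n)) (scal (expi th) (y n))) r ->
    limsup_le y (c * r).

Lemma inv_shift_n M : shift_invariant M ->
  forall k y, M y -> M (fun n => y (n + k)%nat).
Proof.
intros HM; induction k as [|k IH]; intros y Hy.
- apply (inv_ext M HM) with y; [|assumption]; intros n; now rewrite Nat.add_0_r.
- apply (inv_ext M HM) with (fun n => y (S (n + k))).
  + intros n; now rewrite Nat.add_succ_r.
  + now apply (IH (fun n => y (S n))), (inv_shift M HM).
Qed.

Lemma inv_geom_shift M th p y : shift_invariant M -> M y -> M (geom_shift th p y).
Proof.
intros HM Hy; induction p as [|p IH].
- apply (inv_ext M HM) with (fun n => scal (expi (- INR 0 * th)) (y (n + 0)%nat)).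
  + intros n; unfold geom_shift; now rewrite sum_O.
  + now apply (inv_scal M HM), inv_shift_n.
- apply (inv_ext M HM) with (fun n => plus (geom_shift th p y n)
    (scal (expi (- INR (S p) * th)) (y (n + S p)%nat))).
  + intros n; unfold geom_shift; now rewrite sum_Sn.
  + apply (inv_plus M HM); [assumption|].
    now apply (inv_scal M HM), inv_shift_n.
Qed.

Lemma limsup_le_geom_shift_twice M th c p y P : shift_invariant M ->
  0 <= c -> 0 <= P -> shift_bounded_below M th c -> M y -> limsup_le y P ->
  limsup_le (geom_shift th p (geom_shift th p y)) (c * (2 * (c * (2 * P)))).
Proof.
intros HM Hc HP Hb Hy HyP.
assert (H : forall z Q, 0 <= Q -> M z -> limsup_le z Q ->
          limsup_le (geom_shift th p z) (c * (2 * Q))).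
{ intros z Q HQ Hz HzQ; apply Hb; [now apply inv_geom_shift | lra |].
  now apply limsup_le_geom_shift_telescope. }
apply H; [|now apply inv_geom_shift | now apply H].
apply Rmult_le_pos; lra.
Qed.

(** Locally uniform lower bounds are uniform on compact arcs. *)
Lemma shift_bounded_below_compact M a b :
  (forall th, a <= th <= b -> exists t : posreal, forall th', Rabs (th' - th) < t ->
     shift_bounded_below M th' (/ t)) ->
  exists c, 0 <= c /\ forall th, a <= th <= b -> shift_bounded_below M th c.
Proof.
intros H.
destruct (choice (fun th (t : posreal) => a <= th <= b -> forall th',
   Rabs (th' - th) < t -> shift_bounded_below M th' (/ t))) as [delta Hd].
{ intros th; destruct (classic (a <= th <= b)) as [Hth | Hth].
  - destruct (H th Hth) as [t Ht]; exists t; auto.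
  - exists (mkposreal 1 Rlt_0_1); contradiction. }
destruct (compactness_value_1d a b delta) as [d Hd'].
pose proof (cond_pos d) as Hdp.
exists (/ d); split; [now apply Rlt_le, Rinv_0_lt_compat|].
intros th Hth; destruct (NNPP _ (Hd' th Hth)) as [t [Ht [H1 H2]]].
intros y r Hy Hr Hl.
apply limsup_le_weaken with (/ delta t * r).
- apply Rmult_le_compat_r; [assumption|]; now apply Rinv_le_contravar.
- now apply (Hd t Ht th H1).
Qed.

Lemma shift_bounded_below_2PI M th c :
  shift_bounded_below M (th + 2 * PI) c -> shift_bounded_below M th c.
Proof.
intros H y r Hy Hr Hl; apply H; [assumption..|].
replace (expi (th + 2 * PI)) with (expi th); [assumption|].
rewrite expi_add, expi_2PI; ring.
Qed.

(** If the shift on a shift-invariant class of bounded sequences has no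
    approximate eigenvalue on the unit circle except possibly [1], then it acts as
    the identity modulo sequences tending to zero. This is a form of Gelfand's
    theorem on isometries with one-point spectrum. *)
Theorem limsup_le_diff_zero M x P : shift_invariant M -> M x ->
  (forall n, norm (x n) <= P) ->
  (forall th, 0 < th < 2 * PI -> exists t : posreal, forall th', Rabs (th' - th) < t ->
     shift_bounded_below M th' (/ t)) ->
  limsup_le (fun n => minus (x n) (x (S n))) 0.
Proof.
intros HM Hx HxP Hloc; pose proof PI_RGT_0 as Hpi.
assert (HP : 0 <= P) by (apply Rle_trans with (2 := HxP 0%nat); apply norm_ge_0).
apply limsup_le_closed; intros e He; rewrite Rplus_0_l.
(* The width [2 * PI / q] of the near window is fixed before the number [2 * q * s] of
   roots of unity, since the lower bound [c] away from the window depends on [q]. *)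
assert (Hq : exists q, (3 <= q)%nat /\ 3 * (2 * PI / INR q) * P <= e / 2).
{ destruct (nfloor_ex (12 * PI * P / e)) as [q [_ Hq]].
  { apply Rdiv_le_0_compat; [apply Rmult_le_pos; lra | assumption]. }
  exists (q + 3)%nat; split; [lia|].
  assert (Hq0 : 0 < INR (q + 3)) by (apply lt_0_INR; lia).
  assert (Hq1 : 12 * PI * P / e < INR (q + 3))
    by (apply Rlt_le_trans with (1 := Hq); rewrite plus_INR; simpl; lra).
  apply Rmult_le_reg_r with (INR (q + 3)); [assumption|].
  replace (3 * (2 * PI / INR (q + 3)) * P * INR (q + 3))
    with (12 * PI * P / e * (e / 2)) by (field; lra).
  rewrite (Rmult_comm (e / 2)); apply Rmult_le_compat_r; lra. }
destruct Hq as [q [Hq3 Hqe]].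
assert (Hq0 : 3 <= INR q) by (replace 3 with (INR 3) by (simpl; lra); now apply le_INR).
assert (Ha : 0 < PI / INR q) by (apply Rdiv_lt_0_compat; lra).
destruct (shift_bounded_below_compact M (PI / INR q) (2 * PI - PI / INR q))
  as [c [Hc Hcb]]; [intros th Hth; apply Hloc; lra|].
set (D := c * (2 * (c * (2 * P)))).
assert (HD : 0 <= D) by (unfold D; repeat (apply Rmult_le_pos; try lra)).
assert (Hs : exists s, (1 <= s)%nat /\ (2 * D + P) / INR (q * s) <= e / 2).
{ destruct (nfloor_ex ((2 * D + P) / e)) as [s [_ Hs]].
  { apply Rdiv_le_0_compat; lra. }
  exists (s + 1)%nat; split; [lia|].
  assert (Hs1 : (2 * D + P) / e < INR (s + 1))
    by (rewrite plus_INR; simpl; lra).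
  assert (Hs0 : 1 <= INR (s + 1)) by (rewrite plus_INR; pose proof (pos_INR s); simpl; lra).
  rewrite mult_INR.
  assert (Hqs : 2 * INR (s + 1) <= INR q * INR (s + 1))
    by (apply Rmult_le_compat_r; lra).
  apply Rmult_le_reg_r with (INR q * INR (s + 1)); [lra|].
  replace ((2 * D + P) / (INR q * INR (s + 1)) * (INR q * INR (s + 1)))
    with ((2 * D + P) / e * e) by (field; lra).
  apply Rle_trans with (INR (s + 1) * e); [apply Rmult_le_compat_r; lra|].
  apply Rle_trans with (e / 2 * (2 * INR (s + 1))); [lra|].
  apply Rmult_le_compat_l; lra. }
destruct Hs as [s [Hs1 Hse]].
assert (Hs0 : 1 <= INR s) by (change 1 with (INR 1); now apply le_INR).
assert (Hqs : (3 * s <= q * s)%nat) by (apply Nat.mul_le_mono_r; assumption).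
set (p := (q * s - 1)%nat).
assert (Hp : S p = (q * s)%nat) by (unfold p; lia).
assert (Hang : forall i, root_angle p i = PI / INR q / INR s * (INR i - INR (q * s))).
{ intros i; unfold root_angle.
  replace (S (2 * p + 1)) with (2 * (q * s))%nat by lia.
  rewrite Hp; f_equal; rewrite !mult_INR; simpl; field; lra. }
set (h := PI / INR q / INR s) in *.
assert (Hh : 0 < h) by (apply Rdiv_lt_0_compat; lra).
assert (Hhs : h * INR s = PI / INR q) by (unfold h; field; lra).
assert (Hhm : h * INR (q * s) = PI) by (unfold h; rewrite mult_INR; field; lra).
assert (Hq2 : 2 * (PI / INR q) <= PI).
{ apply Rmult_le_reg_r with (INR q); [lra|].
  replace (2 * (PI / INR q) * INR q) with (PI * 2) by (field; lra).
  apply Rmult_le_compat_l; lra. }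
apply limsup_le_weaken with (3 * (2 * PI / INR q) * P + (2 * D + P) / INR (S p));
  [rewrite Hp; lra|].
apply limsup_le_diff with s; try assumption.
- lia.
- apply Rdiv_lt_0_compat; lra.
- now apply limsup_le_bounded.
- intros i Hi; destruct (window_spec p (2 * s) i) as [[_ [H1 H2]] | [H1 _]]; [|lra].
  apply Rle_trans with (1 := Cmod_expi_minus_one _).
  rewrite Hang, Rabs_mult, (Rabs_pos_eq h) by lra.
  replace (2 * PI / INR q) with (h * (2 * INR s)) by (unfold h; field; lra).
  apply Rmult_le_compat_l; [lra|].
  rewrite Hp in H1, H2; apply le_INR in H1, H2.
  rewrite plus_INR, (mult_INR 2) in H1, H2; simpl (INR 2) in H1, H2.
  apply Rabs_le; lra.
- intros i j Hi Hwi Hwj; apply limsup_le_geom_shift_twice with M; try assumption;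
    [|now apply limsup_le_bounded].
  destruct (window_spec p s j) as [[_ [Hj1 Hj2]] | [H _]]; [|lra].
  rewrite Hp in Hj1, Hj2; apply le_INR in Hj1, Hj2; rewrite plus_INR in Hj1, Hj2.
  rewrite !Hang, <- Rmult_plus_distr_l.
  destruct (window_spec p (2 * s) i) as [[H _] | [_ [Hi' | Hi']]]; [lra| |];
    rewrite Hp in Hi'; apply lt_INR in Hi'; rewrite plus_INR, (mult_INR 2) in Hi';
    simpl (INR 2) in Hi'.
  + apply shift_bounded_below_2PI, Hcb.
    pose proof (pos_INR i).
    split; [apply Rle_trans with (h * (- INR (q * s) - INR s) + 2 * PI); [lra|]
           |apply Rle_trans with (h * (- INR s) + 2 * PI); [|lra]];
    apply Rplus_le_compat_r, Rmult_le_compat_l; lra.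
  + apply Hcb.
    assert (INR i <= 2 * INR (q * s))
      by (replace 2 with (INR 2) by (simpl; lra); rewrite <- mult_INR; apply le_INR; lia).
    split; [apply Rle_trans with (h * INR s); [lra|]
           |apply Rle_trans with (h * (INR (q * s) + INR s)); [|lra]];
    apply Rmult_le_compat_l; lra.
Qed.

Lemma norm_minus_le (u v : V) : norm (minus u v) <= norm u + norm v.
Proof. rewrite <- (norm_opp v); exact (norm_triangle u (opp v)). Qed.

Lemma norm_minus_sym (u v : V) : norm (minus u v) = norm (minus v u).
Proof. rewrite <- (norm_opp (minus u v)); f_equal; apply opp_minus. Qed.

Lemma Cmod_inv_pow_le_1 (z : C) i : 1 <= Cmod z -> Cmod (/ z ^ i)%C <= 1.
Proof.
intros Hz.
assert (Hz0 : z <> RtoC 0) by (apply Cmod_gt_0; lra).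
rewrite Cmod_inv by now apply Cpow_nz.
rewrite Cmod_pow, <- Rinv_1; apply Rinv_le_contravar; [lra|].
now apply pow_R1_Rle.
Qed.

(** A sequence that the shift nearly multiplies by [z] is nearly geometric; as
    [|z| >= 1], the errors do not amplify backwards in time. *)
Lemma norm_minus_geometric_le y (z : C) q N j i : 1 <= Cmod z ->
  (forall n, (N <= n)%nat -> norm (minus (y (S n)) (scal z (y n))) <= q) ->
  (N <= j)%nat ->
  norm (minus (y j) (scal (/ z ^ i)%C (y (j + i)%nat))) <= INR i * q.
Proof.
intros Hz Hq Hj.
assert (Hz0 : z <> RtoC 0) by (apply Cmod_gt_0; lra).
induction i as [|i IH].
- rewrite Nat.add_0_r; simpl.
  replace (/ 1)%C with (RtoC 1) by (field; intros E; apply RtoC_inj in E; lra).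
  rewrite Rmult_0_l; right.
  transitivity (norm (zero : V)); [f_equal | exact norm_zero].
  etransitivity; [|apply (minus_eq_zero (y j))].
  f_equal; exact (scal_one (K := C_Ring) (y j)).
- set (b := scal (/ z ^ i)%C (y (j + i)%nat)) in *.
  rewrite (minus_trans b).
  eapply Rle_trans; [exact (norm_triangle (minus (y j) b) (minus b _))|].
  rewrite S_INR, Rmult_plus_distr_r, Rmult_1_l.
  apply Rplus_le_compat; [exact IH|].
  replace (minus b (scal (/ z ^ S i)%C (y (j + S i)%nat)))
    with (scal (/ z ^ S i)%C (minus (scal z (y (j + i)%nat)) (y (j + S i)%nat))).
  + apply Rle_trans with (1 := norm_scal_le _ _).
    rewrite norm_minus_sym, Nat.add_succ_r, <- (Rmult_1_l q).
    apply Rmult_le_compat; [apply Cmod_ge_0 | apply norm_ge_0 | |].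
    * now apply Cmod_inv_pow_le_1.
    * apply Hq; lia.
  + etransitivity; [exact (scal_minus_distr_l (K := C_Ring) _ _ _)|]; f_equal.
    etransitivity; [exact (scal_assoc (K := C_Ring) _ _ _)|]; unfold b; f_equal.
    change (/ z ^ S i * z = / z ^ i)%C; simpl; field; split; [now apply Cpow_nz | assumption].
Qed.

Lemma limsup_le_ge_0 y r : limsup_le y r -> 0 <= r.
Proof.
intros H; apply Rnot_lt_le; intros Hr.
destruct (H (- r / 2) ltac:(lra)) as [N HN].
specialize (HN N (Nat.le_refl N)); pose proof (norm_ge_0 (y N)); lra.
Qed.

End Sequences.

Arguments limsup_le {V}.
Arguments shift_bounded_below {V}.
Arguments shift_invariant {V}.

(** * Asymptotic solutions of the Volterra equation *)

Lemma sum_Sn_head {G : AbelianMonoid} (f : nat -> G) n :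
  sum_n f (S n) = plus (f 0%nat) (sum_n (fun j => f (S j)) n).
Proof.
unfold sum_n; rewrite sum_Sn_m by lia; f_equal; symmetry; apply sum_n_m_S.
Qed.

Lemma sum_n_rev {G : AbelianMonoid} (f : nat -> G) n :
  sum_n (fun j => f (n - j)%nat) n = sum_n f n.
Proof.
induction n as [|n IH]; [now rewrite !sum_O|].
rewrite sum_Sn_head, (sum_Sn f), <- IH, plus_comm; reflexivity.
Qed.

(** The sequence [b] with the terms of index at most [J] replaced by zero. *)
Definition tail (J : nat) (b : nat -> R) (i : nat) : R :=
  if Nat.leb i J then 0 else b i.

Lemma sum_n_le_series (b : nat -> R) n : (forall i, 0 <= b i) -> ex_series b ->
  sum_n b n <= Series b.
Proof.
intros Hb Hs; apply (is_lim_seq_incr_compare (sum_n b)).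
- exact (Series_correct b Hs).
- intros k; rewrite sum_Sn; specialize (Hb (S k)).
  change (sum_n b k <= sum_n b k + b (S k)); lra.
Qed.

Lemma sum_n_tail_le (b : nat -> R) J n : (forall i, 0 <= b i) -> ex_series b ->
  sum_n (tail J b) n <= Series b - sum_n b J.
Proof.
intros Hb Hs.
assert (H : sum_n (tail J b) n = sum_n b (Nat.max n J) - sum_n b J).
{ induction n as [|n IH].
  - rewrite sum_O; simpl; unfold tail; simpl; ring.
  - rewrite sum_Sn, IH; unfold tail; destruct (Nat.leb_spec (S n) J).
    + rewrite (plus_zero_r (G := R_AbelianMonoid)), !Nat.max_r by lia; reflexivity.
    + rewrite !Nat.max_l by lia; rewrite sum_Sn; change (@plus R_AbelianMonoid) with Rplus.
      match goal with |- @eq _ ?u ?v => change (@eq R u v) end; ring. }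
rewrite H; pose proof (sum_n_le_series b (Nat.max n J) Hb Hs); lra.
Qed.

Lemma series_tail_small (b : nat -> R) e : (forall i, 0 <= b i) -> ex_series b ->
  0 < e -> exists J0, forall J n, (J0 <= J)%nat -> sum_n (tail J b) n <= e.
Proof.
intros Hb Hs He.
pose proof (Series_correct b Hs) as Hl.
destruct (proj1 (filterlim_locally _ _) Hl (mkposreal e He)) as [J0 HJ].
exists J0; intros J n HJJ; apply Rle_trans with (1 := sum_n_tail_le b J n Hb Hs).
specialize (HJ J HJJ).
change (Rabs (sum_n b J - Series b) < e) in HJ.
apply Rabs_def2 in HJ; lra.
Qed.

Section Volterra.

Variable X : CompleteNormedModule C_AbsRing.
Local Notation L := (bounded_operator X).
Variable A : L.
Variable B : nat -> L.
Hypothesis HB : ex_series (fun k => norm (B k)).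

Lemma norm_mult_le (S T : L) : norm (mult S T) <= norm S * norm T.
Proof. apply opnorm_mult. Qed.

Lemma mult_scal_r (c : C) (S T : L) : mult S (scal c T) = scal c (mult S T).
Proof. apply bop_ext; intros v; exact (linear_scal _ (bop_linear S) c (T v)). Qed.

(** The defect of [y] as a solution of the Volterra equation. *)
Definition defect (y : nat -> L) (n : nat) : L :=
  minus (y (S n)) (plus (mult A (y n)) (sum_n (fun j => mult (B (n - j)%nat) (y j)) n)).

(** Bounded solutions of the Volterra equation up to an error tending to zero. *)
Definition asymptotic_solution (y : nat -> L) : Prop :=
  (exists K, forall n, norm (y n) <= K) /\ limsup_le (defect y) 0.

Lemma norm_B_to_0 e : 0 < e -> eventually (fun n => norm (B n) <= e).
Proof.
intros He.
destruct (series_tail_small (fun k => norm (B k)) e) as [J HJ];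
  [intros; apply norm_ge_0 | exact HB | exact He |].
exists (S J); intros n Hn.
apply Rle_trans with (2 := HJ J n (Nat.le_refl J)).
destruct n as [|n]; [lia|].
rewrite sum_Sn; unfold tail at 2; rewrite (proj2 (Nat.leb_gt (S n) J)) by lia.
assert (H : 0 <= sum_n (tail J (fun k => norm (B k))) n).
{ apply sum_n_ge_0; intros k _; unfold tail.
  destruct (Nat.leb k J); [lra | apply norm_ge_0]. }
change (norm (B (S n)) <= sum_n (tail J (fun k => norm (B k))) n + norm (B (S n))); lra.
Qed.

Lemma defect_shift y n :
  defect (fun k => y (S k)) n = plus (defect y (S n)) (mult (B (S n)) (y 0%nat)).
Proof.
unfold defect; rewrite sum_Sn_head, Nat.sub_0_r.
change (fun j => mult (B (S n - S j)%nat) (y (S j)))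
  with (fun j => mult (B (n - j)%nat) (y (S j))).
set (u := y (S (S n))); set (a := mult A (y (S n))).
set (b := mult (B (S n)) (y 0%nat)); set (s := sum_n _ n).
assert (G : forall (H : AbelianGroup) (u a b s : H),
  minus u (plus a s) = plus (minus u (plus a (plus b s))) b).
{ clear; intros H u a b s.
  transitivity (plus (plus (minus u (plus a s)) (opp b)) b).
  - symmetry; rewrite <- plus_assoc; etransitivity; [|apply plus_zero_r].
    f_equal; apply plus_opp_l.
  - f_equal; unfold minus; rewrite !opp_plus, <- !plus_assoc; do 2 f_equal.
    apply plus_comm. }
apply G.
Qed.

Lemma defect_plus y z n :
  defect (fun k => plus (y k) (z k)) n = plus (defect y n) (defect z n).
Proof.
unfold defect.
rewrite (sum_n_ext _ (fun j => plus (mult (B (n - j)%nat) (y j)) (mult (B (n - j)%nat) (z j))))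
  by (intros j; apply (mult_distr_l (K := bop_Ring X))).
rewrite sum_n_plus, (mult_distr_l (K := bop_Ring X)).
assert (G : forall (H : AbelianGroup) (u u' a a' s s' : H),
  minus (plus u u') (plus (plus a a') (plus s s'))
  = plus (minus u (plus a s)) (minus u' (plus a' s'))).
{ clear; intros H u u' a a' s s'; unfold minus; rewrite !opp_plus.
  rewrite (plus_plus_interchange (opp a)); apply plus_plus_interchange. }
apply G.
Qed.

Lemma defect_scal c y n :
  defect (fun k => scal c (y k)) n = scal c (defect y n).
Proof.
unfold defect.
rewrite (sum_n_ext _ (fun j => scal c (mult (B (n - j)%nat) (y j))))
  by (intros j; apply mult_scal_r).
rewrite mult_scal_r.
etransitivity; [|symmetry; exact (scal_minus_distr_l (K := C_Ring) _ _ _)]; f_equal.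
etransitivity; [|symmetry; exact (scal_distr_l (K := C_Ring) _ _ _)]; f_equal.
exact (sum_n_scal_l (K := C_Ring) _ _ _).
Qed.

Lemma shift_invariant_asymptotic_solution :
  shift_invariant (V := bop_NormedModule X) asymptotic_solution.
Proof.
constructor.
- intros y z E H; replace z with y; [assumption|].
  now apply FunctionalExtensionality.functional_extensionality.
- intros y [[K HK] H]; split; [exists K; auto|].
  eapply limsup_le_ext; [intros n; symmetry; apply defect_shift|].
  rewrite <- (Rplus_0_r 0); apply (limsup_le_plus (bop_NormedModule X)).
  + apply limsup_le_ext with (fun n => defect y (n + 1)%nat);
      [intros n; now rewrite Nat.add_1_r|].
    now apply limsup_le_shift.
  + intros e He; rewrite Rplus_0_l.
    pose proof (norm_ge_0 (y 0%nat)) as H0.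
    assert (He' : 0 < e / (norm (y 0%nat) + 1)) by (apply Rdiv_lt_0_compat; lra).
    destruct (norm_B_to_0 _ He') as [N HN]; exists N; intros n Hn.
    apply Rle_trans with (1 := norm_mult_le _ _).
    apply Rle_trans with (e / (norm (y 0%nat) + 1) * (norm (y 0%nat) + 1));
      [|right; field; lra].
    apply Rmult_le_compat; try apply norm_ge_0; [apply HN; lia | lra].
- intros y z [[K HK] H] [[K' HK'] H']; split.
  + exists (K + K'); intros n; apply Rle_trans with (1 := norm_triangle _ _).
    now apply Rplus_le_compat.
  + eapply limsup_le_ext; [intros n; symmetry; apply defect_plus|].
    rewrite <- (Rplus_0_r 0); now apply (limsup_le_plus (bop_NormedModule X)).
- intros c y [[K HK] H]; split.
  + exists (Cmod c * K); intros n.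
    apply Rle_trans with (1 := norm_scal_le (bop_NormedModule X) _ _).
    apply Rmult_le_compat_l; [apply Cmod_ge_0 | auto].
  + eapply limsup_le_ext; [intros n; symmetry; apply defect_scal|].
    rewrite <- (Rmult_0_r (Cmod c)); now apply (limsup_le_scal (bop_NormedModule X)).
Qed.


(** * Lower bounds from the Z-transform *)

Let b (k : nat) : R := norm (B k).

Lemma norm_B_ge_0 k : 0 <= b k.
Proof. apply norm_ge_0. Qed.

(** If the shift nearly multiplies [y] by [z], the convolution of [B] with [y] at [n]
    is close to the truncated Z-transform of [B] at [z] applied to [y n]. *)
Lemma limsup_le_convolution (y : nat -> L) (z : C) K J tau r eta : 1 <= Cmod z -> 0 <= eta ->
  (forall n, norm (y n) <= K) -> limsup_le y r ->
  limsup_le (fun n => minus (y (S n)) (scal z (y n))) eta ->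
  (forall n, sum_n (tail J b) n <= tau) ->
  limsup_le (fun n => sum_n (fun j => mult (B (n - j)%nat)
                (minus (y j) (scal (/ z ^ (n - j))%C (y n)))) n)
    (Series b * INR J * eta + 2 * tau * r).
Proof.
intros Hz Heta HK Hr Hs Htau e He.
pose proof (limsup_le_ge_0 (bop_NormedModule X) y r Hr) as Hr0.
assert (HK0 : 0 <= K) by (apply Rle_trans with (2 := HK 0%nat); apply norm_ge_0).
assert (Hbeta : 0 <= Series b).
{ apply Rle_trans with (2 := sum_n_le_series b 0 norm_B_ge_0 HB); rewrite sum_O; apply norm_B_ge_0. }
assert (Htau0 : 0 <= tau).
{ apply Rle_trans with (2 := Htau 0%nat); rewrite sum_O; unfold tail; simpl; lra. }
pose proof (pos_INR J) as HJ0.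
assert (HbJ : 0 <= Series b * INR J) by now apply Rmult_le_pos.
set (d := e / 2 / (Series b * INR J + 2 * tau + 1)).
assert (Hd : 0 < d) by (unfold d; repeat apply Rdiv_lt_0_compat; lra).
assert (Hd' : (Series b * INR J + 2 * tau) * d <= e / 2).
{ apply Rle_trans with ((Series b * INR J + 2 * tau + 1) * d);
    [apply Rmult_le_compat_r; lra | right; unfold d; field; lra]. }
destruct (filter_and (F := eventually) _ _ (Hr d Hd) (Hs d Hd)) as [N HN].
destruct (series_tail_small b (e / 2 / (2 * K + 1)) norm_B_ge_0 HB) as [J0 HJ0'];
  [repeat apply Rdiv_lt_0_compat; lra|].
exists (N + J0)%nat; intros n Hn.
apply Rle_trans with (1 := norm_sum_n (V := bop_NormedModule X) _ _).
(* The norm of the factor of [B i], [i = n - j], is at most [J * (eta + d)] if [i <= J]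
   and [j >= N], at most [2 * (r + d)] if [j >= N], and at most [2 * K] in any case. *)
apply Rle_trans with (sum_n (fun i => b i * (INR J * (eta + d))
  + (tail J b i * (2 * (r + d)) + tail (n - N) b i * (2 * K))) n).
- rewrite <- (sum_n_rev (fun i => b i * (INR J * (eta + d))
    + (tail J b i * (2 * (r + d)) + tail (n - N) b i * (2 * K)))).
  apply sum_n_le; intros j Hj; cbv beta.
  apply Rle_trans with (1 := norm_mult_le _ _).
  set (i := (n - j)%nat).
  set (w := norm _ * norm _).
  assert (Hw : forall q, norm (minus (y j) (scal (/ z ^ i)%C (y n))) <= q -> w <= b i * q)
    by (intros q Hq; apply Rmult_le_compat_l; [apply norm_ge_0 | exact Hq]).
  assert (H2 : forall q, norm (y j) <= q -> norm (y n) <= q -> w <= b i * (2 * q)).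
  { intros q H1 H2; apply Hw.
    apply Rle_trans with (1 := norm_minus_le (bop_NormedModule X) _ _).
    assert (norm (scal (/ z ^ i)%C (y n)) <= norm (y n)); [|lra].
    apply Rle_trans with (1 := norm_scal_le (bop_NormedModule X) _ _).
    rewrite <- (Rmult_1_l (norm (y n))) at 2; apply Rmult_le_compat_r;
      [apply norm_ge_0 | now apply Cmod_inv_pow_le_1]. }
  pose proof (norm_B_ge_0 i) as Hbi.
  assert (HA : 0 <= b i * (INR J * (eta + d))) by (repeat apply Rmult_le_pos; lra).
  assert (HB' : 0 <= tail J b i * (2 * (r + d))).
  { unfold tail; destruct (Nat.leb i J); [lra | apply Rmult_le_pos; lra]. }
  assert (HC : 0 <= tail (n - N) b i * (2 * K)).
  { unfold tail; destruct (Nat.leb i (n - N)); [lra | apply Rmult_le_pos; lra]. }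
  destruct (Nat.le_gt_cases N j) as [HNj | HNj].
  + destruct (Nat.le_gt_cases i J) as [HiJ | HiJ].
    * assert (w <= b i * (INR J * (eta + d))); [|lra].
      apply Hw; apply Rle_trans with (INR i * (eta + d)).
      -- replace n with (j + i)%nat by (unfold i; lia).
         apply (norm_minus_geometric_le (bop_NormedModule X) y z (eta + d) N); [assumption | | assumption].
         intros k Hk; now apply HN.
      -- apply Rmult_le_compat_r; [lra | now apply le_INR].
    * assert (w <= tail J b i * (2 * (r + d))); [|lra].
      unfold tail; rewrite (proj2 (Nat.leb_gt i J)) by lia.
      apply H2; apply HN; lia.
  + assert (w <= tail (n - N) b i * (2 * K)); [|lra].
    unfold tail; rewrite (proj2 (Nat.leb_gt i (n - N))) by (unfold i; lia).
    apply H2; apply HK.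
- rewrite (sum_n_plus (G := R_AbelianMonoid) (fun i => b i * (INR J * (eta + d)))
    (fun i => tail J b i * (2 * (r + d)) + tail (n - N) b i * (2 * K))).
  rewrite (sum_n_plus (G := R_AbelianMonoid) (fun i => tail J b i * (2 * (r + d)))
    (fun i => tail (n - N) b i * (2 * K))).
  rewrite !(sum_n_mult_r (K := R_Ring)).
  change (sum_n b n * (INR J * (eta + d)) + (sum_n (tail J b) n * (2 * (r + d))
    + sum_n (tail (n - N) b) n * (2 * K)) <= Series b * INR J * eta + 2 * tau * r + e).
  assert (H1 : sum_n b n * (INR J * (eta + d)) <= Series b * (INR J * (eta + d))).
  { apply Rmult_le_compat_r; [apply Rmult_le_pos; lra|].
    apply (sum_n_le_series b n norm_B_ge_0 HB). }
  assert (H2 : sum_n (tail J b) n * (2 * (r + d)) <= tau * (2 * (r + d)))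
    by (apply Rmult_le_compat_r; [lra | apply Htau]).
  assert (H3 : sum_n (tail (n - N) b) n * (2 * K) <= e / 2).
  { apply Rle_trans with (e / 2 / (2 * K + 1) * (2 * K)).
    - apply Rmult_le_compat_r; [lra | apply HJ0'; lia].
    - apply Rle_trans with (e / 2 / (2 * K + 1) * (2 * K + 1));
        [apply Rmult_le_compat_l; [apply Rlt_le; repeat apply Rdiv_lt_0_compat|]; lra
        |right; field; lra]. }
  lra.
Qed.

Lemma mult_minus_l (S T U : L) : mult (minus S T) U = minus (mult S U) (mult T U).
Proof. now apply bop_ext. Qed.

Lemma mult_minus_r (S T U : L) : mult S (minus T U) = minus (mult S T) (mult S U).
Proof.
apply bop_ext; intros v.
change (S (plus (T v) (opp (U v))) = plus (S (T v)) (opp (S (U v)))).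
now rewrite (linear_plus _ (bop_linear S)), (linear_opp _ _ (bop_linear S)).
Qed.

(** With [T] the Z-transform of [B] at [z], the operator [z - A - T] maps [y n] to a
    sum of terms that are all small when [y] is an asymptotic solution that the shift
    nearly multiplies by [z]. *)
Lemma characteristic_operator_split (y : nat -> L) (z : C) (T : L) n :
  mult (minus (minus (scal z (one : L)) A) T) (y n)
  = plus (opp (minus (y (S n)) (scal z (y n))))
     (plus (defect y n)
       (plus (sum_n (fun j => mult (B (n - j)%nat)
                (minus (y j) (scal (/ z ^ (n - j))%C (y n)))) n)
         (mult (minus (sum_n (fun j => scal (/ z ^ j)%C (B j)) n) T) (y n)))).
Proof.
assert (E : sum_n (fun j => mult (B (n - j)%nat)
                (minus (y j) (scal (/ z ^ (n - j))%C (y n)))) n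
   = minus (sum_n (fun j => mult (B (n - j)%nat) (y j)) n)
       (mult (sum_n (fun j => scal (/ z ^ j)%C (B j)) n) (y n))).
{ rewrite <- (sum_n_rev (fun j => scal (/ z ^ j)%C (B j))).
  rewrite <- (sum_n_mult_r (K := bop_Ring X) (y n)).
  set (f j := mult (B (n - j)%nat) (y j)).
  set (g j := mult (scal (/ z ^ (n - j))%C (B (n - j)%nat)) (y n) : L).
  transitivity (sum_n (fun j => minus (f j) (g j)) n).
  - apply sum_n_ext; intros j; unfold f, g.
    etransitivity; [exact (mult_minus_r _ _ _)|].
    f_equal; rewrite mult_scal_r; now apply bop_ext.
  - exact (sum_n_minus f g n). }
rewrite E; clear E.
etransitivity; [exact (mult_minus_l _ _ _)|].
etransitivity; [exact (f_equal (fun u => minus u _)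
  (mult_minus_l _ _ _))|].
etransitivity; [|exact (f_equal (fun u => plus _ (plus _ (plus _ u)))
  (eq_sym (mult_minus_l _ _ _)))].
replace (mult (scal z (one : L)) (y n)) with (scal z (y n)) by now apply bop_ext.
exact (minus_split _ _ _ _ _ _).
Qed.

(** Outside the open unit disk, the shift minus [z] is bounded below on asymptotic
    solutions as soon as [z - A - T], with [T] the Z-transform of [B] at [z], has a left
    inverse [Q]. The constant depends on [z] only through a bound [c] of [|Q|]. *)
Lemma asymptotic_solution_bounded_below (y : nat -> L) (z : C) (T Q : L) c J eta :
  asymptotic_solution y -> 1 <= Cmod z -> 0 <= eta ->
  is_Ztransform B z T -> mult Q (minus (minus (scal z (one : L)) A) T) = one ->
  0 < c -> norm Q <= c -> (forall n, sum_n (tail J b) n <= / (4 * c)) ->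
  limsup_le (fun n => minus (y (S n)) (scal z (y n))) eta ->
  limsup_le y (2 * (c * (1 + Series b * INR J)) * eta).
Proof.
intros [[K HK] Hdef] Hz Heta HT HQ Hc HQc Htail Hs.
rewrite Rmult_assoc; apply (limsup_le_absorb (bop_NormedModule X) y K); [exact HK|].
intros r Hr.
assert (HK0 : 0 <= K) by (apply Rle_trans with (2 := HK 0%nat); apply norm_ge_0).
assert (HZ : limsup_le (fun n => mult (minus (sum_n (fun j => scal (/ z ^ j)%C (B j)) n) T)
                                   (y n)) 0).
{ intros e He; rewrite Rplus_0_l.
  assert (He' : 0 < e / (K + 1)) by (apply Rdiv_lt_0_compat; lra).
  destruct (proj1 (filterlim_locally _ _) HT (mkposreal _ He')) as [N HN].
  exists N; intros n Hn; apply Rle_trans with (1 := norm_mult_le _ _).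
  apply Rle_trans with (e / (K + 1) * (K + 1)); [|right; field; lra].
  apply Rmult_le_compat; try apply norm_ge_0.
  - apply Rlt_le; exact (HN n Hn).
  - apply Rle_trans with (1 := HK n); lra. }
assert (HW := limsup_le_convolution y z K J _ r eta Hz Heta HK Hr Hs Htail).
assert (Hopp : limsup_le (fun n => opp (minus (y (S n)) (scal z (y n)))) eta).
{ intros e He; generalize (Hs e He); apply filter_imp; intros n H.
  now rewrite (norm_opp (V := bop_NormedModule X)). }
pose proof (limsup_le_plus _ _ _ _ _ Hopp (limsup_le_plus _ _ _ _ _ Hdef
  (limsup_le_plus _ _ _ _ _ HW HZ))) as Hall.
apply limsup_le_weaken with
  (c * (eta + (0 + ((Series b * INR J * eta + 2 * / (4 * c) * r) + 0)))).
{ right; field; lra. }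
apply limsup_le_ext with (fun n => mult Q (mult (minus (minus (scal z (one : L)) A) T) (y n))).
{ intros n; rewrite mult_assoc, HQ; apply (mult_one_l (K := bop_Ring X)). }
intros e He; destruct (Hall (e / c) (Rdiv_lt_0_compat _ _ He Hc)) as [N HN].
exists N; intros n Hn; specialize (HN n Hn); cbv beta in HN.
apply Rle_trans with (1 := norm_mult_le _ _).
rewrite characteristic_operator_split.
eapply Rle_trans; [apply Rmult_le_compat;
  [apply norm_ge_0 | apply norm_ge_0 | exact HQc | exact HN]|].
right; field; lra.
Qed.

(** * Regular points *)

(** Near a regular point of the circle the shift is locally uniformly bounded below
    on asymptotic solutions. The bound is obtained at a nearby point outside the
    closed disk, where the Z-transform converges, and moved to the circle. *)
Lemma regular_point_bounded_below th : regular_point A B (expi th) ->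
  exists t : posreal, forall th', Rabs (th' - th) < t ->
    shift_bounded_below (V := bop_NormedModule X) asymptotic_solution th' (/ t).
Proof.
intros [r [Hr [Bt [_ [HBt [Res [Hinv Hhol]]]]]]].
assert (Hc : continuous (T := AbsRing_UniformSpace C_AbsRing) Res (expi th)).
{ apply (ex_derive_continuous (V := bop_NormedModule X) Res (expi th)), Hhol.
  unfold open_disk.
  replace (expi th - expi th)%C with (RtoC 0) by ring; now rewrite Cmod_0. }
destruct (proj1 (filterlim_locally _ _) Hc (mkposreal 1 Rlt_0_1)) as [d Hd].
set (c := norm (Res (expi th)) + 1).
assert (Hc0 : 0 < c) by (pose proof (norm_ge_0 (Res (expi th))); unfold c; lra).
assert (HRes : forall z, Cmod (z - expi th)%C < d -> norm (Res z) <= c).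
{ intros z Hz; specialize (Hd z Hz).
  change (norm (minus (Res z) (Res (expi th))) < 1) in Hd.
  assert (H : Rabs (norm (Res z) - norm (Res (expi th)))
              <= norm (minus (Res z) (Res (expi th))))
    by exact (norm_triangle_inv (V := bop_NormedModule X) (Res z) (Res (expi th))).
  apply Rabs_le_between in H; unfold c; lra. }
destruct (series_tail_small b (/ (4 * c)) norm_B_ge_0 HB) as [J HJ];
  [apply Rinv_0_lt_compat; lra|].
set (c1 := 2 * (c * (1 + Series b * INR J))).
assert (Hc1 : 0 < c1).
{ unfold c1; repeat apply Rmult_lt_0_compat; try lra.
  assert (0 <= Series b * INR J); [|lra].
  apply Rmult_le_pos; [|apply pos_INR].
  apply Rle_trans with (2 := sum_n_le_series b 0 norm_B_ge_0 HB).
  rewrite sum_O; apply norm_B_ge_0. }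
set (t := Rmin (Rmin (r / 2) (d / 2)) (/ (4 * c1))).
pose proof (cond_pos d) as Hd0.
assert (Ht : 0 < t).
{ unfold t; repeat apply Rmin_glb_lt; try lra; apply Rinv_0_lt_compat; lra. }
assert (Htr : t <= r / 2)
  by (eapply Rle_trans; [apply Rmin_l | apply Rmin_l]).
assert (Htd : t <= d / 2)
  by (eapply Rle_trans; [apply Rmin_l | apply Rmin_r]).
assert (Htc : 4 * c1 * t <= 1).
{ apply Rle_trans with (4 * c1 * / (4 * c1)).
  - apply Rmult_le_compat_l; [lra | apply Rmin_r].
  - right; field; lra. }
exists (mkposreal t Ht); simpl; intros th' Hth' y eta Hy Heta Hs.
set (z := (RtoC (1 + t) * expi th)%C).
assert (Hzth : Cmod (z - expi th)%C = t).
{ unfold z; rewrite RtoC_plus.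
  replace ((1 + t) * expi th - expi th)%C with (RtoC t * expi th)%C by ring.
  rewrite Cmod_mult, Cmod_expi, Cmod_R, Rabs_pos_eq; lra. }
assert (Hz : Cmod z = 1 + t).
{ unfold z; rewrite Cmod_mult, Cmod_expi, Cmod_R, Rabs_pos_eq; lra. }
assert (Hzth' : Cmod (expi th' - z)%C <= 2 * t).
{ replace (expi th' - z)%C with ((expi th' - expi th) + - (z - expi th))%C by ring.
  apply Rle_trans with (1 := Cmod_triangle _ _); rewrite Cmod_opp, Hzth.
  pose proof (Cmod_expi_minus th' th); lra. }
destruct (proj1 Hy) as [K HK].
apply limsup_le_weaken with (2 * (c1 * eta)).
{ rewrite <- Rmult_assoc; apply Rmult_le_compat_r; [assumption|].
  apply Rmult_le_reg_r with t; [assumption|].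
  rewrite Rinv_l by lra.
  assert (0 < c1 * t) by now apply Rmult_lt_0_compat.
  lra. }
apply (limsup_le_absorb (bop_NormedModule X) y K); [exact HK|].
intros q Hq.
pose proof (limsup_le_ge_0 (bop_NormedModule X) y q Hq) as Hq0.
apply limsup_le_weaken with (c1 * (eta + 2 * t * q)).
{ rewrite Rmult_plus_distr_l; apply Rplus_le_compat_l.
  replace (c1 * (2 * t * q)) with (4 * c1 * t * (q / 2)) by field.
  rewrite <- (Rmult_1_l (q / 2)) at 2; apply Rmult_le_compat_r; lra. }
assert (Hdisk : open_disk (expi th) r z) by (unfold open_disk; lra).
apply (asymptotic_solution_bounded_below y z (Bt z) (Res z)); try assumption.
- lra.
- apply Rplus_le_le_0_compat; [lra | apply Rmult_le_pos; lra].
- apply HBt; [assumption | lra].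
- now apply Hinv.
- apply HRes; lra.
- intros n; now apply HJ.
- apply limsup_le_ext with (fun n => plus (minus (y (S n)) (scal (expi th') (y n)))
    (scal (expi th' - z)%C (y n))).
  + intros n.
    transitivity (plus (minus (y (S n)) (scal (expi th') (y n)))
      (minus (scal (expi th') (y n)) (scal z (y n)))).
    * f_equal; exact (scal_minus_distr_r (K := C_Ring) _ _ _).
    * symmetry; apply minus_trans.
  + apply (limsup_le_plus (bop_NormedModule X)); [assumption|].
    apply limsup_le_weaken with (Cmod (expi th' - z)%C * q);
      [now apply Rmult_le_compat_r|].
    now apply (limsup_le_scal (bop_NormedModule X)).
Qed.

End Volterra.

Theorem theorem4p8 (X : CompleteNormedModule C_AbsRing)
    (A : bounded_operator X) (B : nat -> bounded_operator X)
    (x : nat -> bounded_operator X)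
    (hB : ex_series (fun k => norm (B k)))
    (hSigma : forall z : C, singular_set A B z -> z = RtoC 1)
    (hx : is_resolvent_sequence A B x)
    (hbounded : exists M : R, forall n : nat, norm (x n) <= M) :
  filterlim (fun n => minus (x (S n)) (x n)) eventually (locally (zero : bounded_operator X)).
Proof.
destruct hbounded as [P HP].
assert (H : limsup_le (fun n => minus (x n) (x (S n))) 0).
{ apply (limsup_le_diff_zero (bop_NormedModule X) (asymptotic_solution X A B) x P).
  - now apply shift_invariant_asymptotic_solution.
  - split; [now exists P|].
    apply limsup_le_bounded; intros n; right.
    unfold defect; rewrite (proj2 hx n).
    etransitivity; [|exact (norm_zero (V := bop_NormedModule X))].
    f_equal; exact (minus_eq_zero (G := bop_AbelianGroup X) _).
  - exact HP.
  - intros th Hth; apply regular_point_bounded_below; [exact hB|].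
    apply NNPP; intros Hsing; apply (expi_neq_1 th Hth).
    apply hSigma; split; [apply Cmod_expi | exact Hsing]. }
apply filterlim_locally; intros e.
pose proof (cond_pos e) as He.
generalize (H (e / 2) ltac:(lra)); apply filter_imp; intros n Hn.
apply (norm_compat1 (V := bop_NormedModule X)).
apply Rle_lt_trans with (norm (minus (x (S n)) (x n))).
- right; apply (f_equal (norm (V := bop_NormedModule X))).
  exact (minus_zero_r (G := bop_AbelianGroup X) _).
- rewrite (norm_minus_sym (bop_NormedModule X)).
  apply Rle_lt_trans with (1 := Hn); lra.
Qed.
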